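(* Let $G$ be a group with identity $e$. The $N$-free two-sided invariant partial orders on $G$ are in one-to-one correspondence with the reduced admissible two-coloured subgroup chains on $G$, as follows. Given a reduced admissible two-coloured subgroup chain $\mathcal H$ on $G$, the corresponding order is determined thus. For $g\ne e$, let $H_g$ be the least member of $\mathcal H$ containing $g$. Then $$g>e\iff H_g\text{ has type }\mathbf C\text{ and }gH_g^->H_g^-\text{ in }H_g/H_g^-,$$ while $g$ is incomparable with $e$ when $H_g$ has type $\mathbf A$; for arbitrary $x,y\in G$, $x<y\iff x^{-1}y>e$. Conversely, if $G$ is equipped with an $N$-free two-sided invariant partial order, then its canonical chain $\mathcal V(G)$, with a level $H$ coloured $\mathbf C$ when $H/H^-$ is totally ordered and $\mathbf A$ when $H/H^-$ is equality-ordered, is the corresponding reduced admissible chain. In particular, $H_g=S(e,g)$ for all $g\ne e$.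
   Context: A two-sided invariant partial order on $G$ is a partial order $\le$ with $x\le y\Rightarrow axb\le ayb$ for all $a,b,x,y\in G$; $G$ with such an order is an ordered group. A poset is $N$-free if it has no four distinct elements $a,b,c,d$ whose only strict comparabilities among themselves are $a<b$, $c<b$, $c<d$. A two-coloured subgroup chain on $G$ is a set $\mathcal H$ of subgroups of $G$ forming a chain under inclusion, each member being assigned one of two types, $\mathbf C$ or $\mathbf A$. For $H\in\mathcal H$ put $H^-:=\{e\}\cup\bigcup\{K\in\mathcal H:K\subsetneq H\}$. It is admissible if: (i) every $g\ne e$ belongs to a least member $H_g$ of $\mathcal H$; (ii) $H^-$ is a proper normal subgroup of $H$ for every $H\in\mathcal H$; (iii) if $H$ has type $\mathbf C$, then $H/H^-$ is equipped with a total group order (this order is part of the data of the chain), while if $H$ has type $\mathbf A$, then $H/H^-$ has the equality order; (iv) conjugation by every element of $G$ preserves the chain and its types, and induces order isomorphisms between the corresponding quotients $H/H^-$ of type $\mathbf C$. It is reduced if whenever $K\subsetneq H$ in $\mathcal H$ have the same type, there exists $L\in\mathcal H$ of the opposite type with $K\subsetneq L\subsetneq H$. A module of a poset $X$ is a subset $M$ such that for every $x\in X\setminus M$ and $m,m'\in M$: $x\le m\iff x\le m'$ and $m\le x\iff m'\le x$. A nonempty module $M$ is strong if every module is disjoint from $M$, contained in $M$, or contains $M$. $S(x,y)$ is the least strong module containing $x,y$. For an ordered group $G$, the canonical chain is $\mathcal V(G):=\{S(e,g):g\ne e\}$, and $H^-:=\{e\}\cup\bigcup\{K\in\mathcal V(G):K\subsetneq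 H\}$ for $H\in\mathcal V(G)$. It is known that $\mathcal V(G)$ is a chain of convex subgroups and that $H^-$ is a proper convex normal subgroup of $H$; $H/H^-$ carries the quotient order ($\alpha\le\beta$ iff $a\le b$ for some $a\in\alpha$, $b\in\beta$). *)

(* Defs.v *)
From mathcomp Require Import all_boot.
From mathcomp Require Import classical_sets.

Set Implicit Arguments.
Unset Strict Implicit.
Unset Printing Implicit Defensive.

Local Open Scope classical_set_scope.
Local Open Scope group_scope.

Definition strict (T : Type) (le : T -> T -> Prop) (x y : T) : Prop :=
  le x y /\ x <> y.

Definition incomparable (T : Type) (le : T -> T -> Prop) (x y : T) : Prop :=
  ~ le x y /\ ~ le y x.

Definition partial_order_on (T : Type) (D : set T) (le : T -> T -> Prop) :=
  [/\ forall x, D x -> le x x,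
      forall x y, D x -> D y -> le x y -> le y x -> x = y &
      forall x y z, D x -> D y -> D z -> le x y -> le y z -> le x z].

Definition total_order_on (T : Type) (D : set T) (le : T -> T -> Prop) :=
  partial_order_on D le /\ total_on D le.

Definition equality_order_on (T : Type) (D : set T) (le : T -> T -> Prop) :=
  forall x y, D x -> D y -> (le x y <-> x = y).

Definition N_free (T : eqType) (le : T -> T -> Prop) : Prop :=
  forall a b c d : T, uniq [:: a; b; c; d] ->
    ~ {in [:: a; b; c; d] &, forall x y,
        strict le x y <-> (x, y) \in [:: (a, b); (c, b); (c, d)]}.

Definition least (T : Type) (F : set (set T)) (M : set T) : Prop :=
  F M /\ forall M', F M' -> M `<=` M'.

Section Modules.
Variables (T : Type) (le : T -> T -> Prop).

Definition is_module (M : set T) : Prop :=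
  forall x m m', ~ M x -> M m -> M m' ->
    (le x m <-> le x m') /\ (le m x <-> le m' x).

Definition is_strong_module (M : set T) : Prop :=
  [/\ is_module M, M !=set0 &
      forall M', is_module M' ->
        [\/ M' `&` M = set0, M' `<=` M | M `<=` M']].

(* [is_S x y M] means that S(x, y) exists and is equal to M. *)
Definition is_S (x y : T) (M : set T) : Prop :=
  least [set M' | [/\ is_strong_module M', M' x & M' y]] M.

End Modules.

Section Groups.
Variable G : groupType.
Implicit Types (H K L N : set G) (le : G -> G -> Prop).

Definition is_subgroup H : Prop :=
  [/\ H 1, forall x y, H x -> H y -> H (x * y) & forall x, H x -> H x^-1].

Definition is_normal_in N H : Prop :=
  [/\ is_subgroup N, N `<=` H & forall h x, H h -> N x -> N (x ^ h)].

Definition lcoset_of (g : G) N : set G := [set g * x | x in N].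

Definition quotient H N : set (set G) := [set lcoset_of h N | h in H].

Definition set_mul (X Y : set G) : set G :=
  [set x * y | x in X & y in Y].

Definition set_conj (g : G) (X : set G) : set G := [set x ^ g | x in X].

Definition is_group_order le : Prop :=
  partial_order_on setT le /\
  forall a b x y, le x y -> le (a * x * b) (a * y * b).

(* For [Q = quotient H N] with N normal in H, [set_mul] is the group law
   of H/N. *)
Definition is_total_group_order (Q : set (set G))
    (le : set G -> set G -> Prop) : Prop :=
  total_order_on Q le /\
  forall a b x y, Q a -> Q b -> Q x -> Q y ->
    le x y -> le (set_mul (set_mul a x) b) (set_mul (set_mul a y) b).

(* H^- relative to the family [V] of levels. *)
Definition lower (V : set (set G)) H : set G :=
  [set 1] `|` \bigcup_(K in [set K | V K /\ K `<` H]) K.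

(* [qle H] is the order on the quotient of the level H by H^-. *)
Record chain_data := ChainData {
  typeC : set (set G);
  typeA : set (set G);
  qle : set G -> set G -> set G -> Prop }.

Implicit Type c : chain_data.

Definition levels c : set (set G) := typeC c `|` typeA c.

Definition level_quotient c H : set (set G) :=
  quotient H (lower (levels c) H).

Definition least_level c (g : G) H : Prop :=
  least [set K | levels c K /\ K g] H.

(* The last clause makes [qle] false outside the quotients of the levels, so
   that two chains with the same levels, types and quotient orders are equal
   as elements of [chain_data]. *)
Definition is_two_coloured_chain c : Prop :=
  [/\ forall H, levels c H -> is_subgroup H,
      total_on (levels c) subset,
      typeC c `&` typeA c = set0 &
      forall H X Y, qle c H X Y ->
        [/\ levels c H, level_quotient c H X & level_quotient c H Y]].

Definition admissible c : Prop :=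
  [/\ forall g, g <> 1 -> exists H, least_level c g H,
      forall H, levels c H ->
        is_normal_in (lower (levels c) H) H /\ lower (levels c) H `<` H,
      (forall H, typeC c H ->
         is_total_group_order (level_quotient c H) (qle c H)) /\
      (forall H, typeA c H ->
         equality_order_on (level_quotient c H) (qle c H)) &
      forall g,
        [/\ forall H, typeC c H -> typeC c (set_conj g H),
            forall H, typeA c H -> typeA c (set_conj g H) &
            forall H X Y, typeC c H ->
              level_quotient c H X -> level_quotient c H Y ->
              (qle c H X Y <->
               qle c (set_conj g H) (set_conj g X) (set_conj g Y))]].

Definition reduced c : Prop :=
  (forall K H, typeC c K -> typeC c H -> K `<` H ->
     exists L, [/\ typeA c L, K `<` L & L `<` H]) /\
  (forall K H, typeA c K -> typeA c H -> K `<` H ->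
     exists L, [/\ typeC c L, K `<` L & L `<` H]).

Definition reduced_admissible_chain : Type :=
  {c : chain_data | [/\ is_two_coloured_chain c, admissible c & reduced c]}.

Definition N_free_group_order : Type :=
  {le : G -> G -> Prop | is_group_order le /\ N_free le}.

Definition canonical_levels le : set (set G) :=
  [set H | exists2 g, g <> 1 & is_S le 1 g H].

Definition canonical_quotient le H : set (set G) :=
  quotient H (lower (canonical_levels le) H).

Definition quotient_le le (X Y : set G) : Prop :=
  exists x y, [/\ X x, Y y & le x y].

End Groups.

(* Main.v *)
(* Translations, conjugations and inversion map strong modules to strong
   modules, since they are automorphisms or anti-automorphisms of the
   order. Inversion maps S(1, g) into a nested strong module, which forces
   S(1, g) to be closed under inversion, and then to be a subgroup. If x
   and y are comparable and z is incomparable to both, the component of x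
   in the comparability graph of the elements incomparable to z is a strong
   module separating x, y from z (the same holds with comparability and
   incomparability exchanged); so in a canonical level H the elements
   outside H^- are all comparable to 1 or all incomparable to 1. Two
   consecutive levels of the same type would allow a module overlapping the
   smaller one, which gives reducedness. Conversely, in an order defined by
   a chain, the level of x^-1 y is an ultrametric whose value decides
   whether x and y are comparable; this excludes N, and reducedness makes
   every level a strong module. *)
Require Import Defs.
From mathcomp Require Import all_boot.
From mathcomp Require Import classical_sets boolp.

Set Implicit Arguments.
Unset Strict Implicit.
Unset Printing Implicit Defensive.

Local Open Scope classical_set_scope.
Local Open Scope group_scope.

(** * Strong modules generated by two points, and their behaviour under symmetries *)

Section Span.
Variables (T : Type) (le : T -> T -> Prop).
Implicit Types (M : set T).

Definition comparable x y := strict le x y \/ strict le y x.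

(** This intersection is S(x, y): it is itself a strong module, so the least one containing [x] and
    [y] always exists. *)
Definition span (x y : T) : set T :=
  [set z | forall M, is_strong_module le M -> M x -> M y -> M z].

(** Two comparisons with the base point [o] chain together, so the module condition need not be
    checked for pairs of members. In groups the base point is 1. *)
Lemma module_from_base M o :
    (forall w m, ~ M w -> M m ->
       (le w m <-> le w o) /\ (le m w <-> le o w)) ->
  is_module le M.
Proof.
move=> Mo w m m' Mw Mm Mm'.
by have [? ?] := Mo w m Mw Mm; have [? ?] := Mo w m' Mw Mm'; split; tauto.
Qed.

Lemma span_l x y : span x y x. Proof. by []. Qed.

Lemma span_sub x y M : is_strong_module le M -> M x -> M y -> span x y `<=` M.
Proof. by move=> sM Mx My z; apply. Qed.

Lemma spanC x y : span x y = span y x.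
Proof. by apply/seteqP; split=> z sz M sM Mx My; apply: sz. Qed.

(** A point outside the intersection lies outside one strong module of the family, which already
    treats all points of the span alike. For a module [M'], either some member of the family is
    disjoint from it, or some member lies inside it, or else every member contains it; each
    alternative passes to the intersection. *)
Lemma span_strong x y : is_strong_module le (span x y).
Proof.
split; last 2 first.
- by exists x.
- move=> M' mM'.
  have [[M [sM Mx My dM]]|nd] := EM (exists M,
    [/\ is_strong_module le M, M x, M y & M' `&` M = set0]).
    apply: Or31; rewrite -subset0 -dM => z [M'z sz]; split=> //.
    exact: sz.
  have [[M [sM Mx My dM]]|ns] := EM (exists M,
    [/\ is_strong_module le M, M x, M y & M `<=` M']).
    by apply: Or33 => z sz; apply: dM; apply: sz.
  apply: Or32 => z M'z M sM Mx My.
  have [_ _ /(_ _ mM')[dM|sM'|sM']] := sM.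
  + by case: nd; exists M.
  + exact: sM'.
  + by case: ns; exists M.
- move=> w m m' nw sm sm'.
  have [M [sM [Mx [My nMw]]]] : exists M, is_strong_module le M /\
      M x /\ M y /\ ~ M w.
    apply: contrapT => h; apply: nw => M sM Mx My; apply: contrapT => Mw.
    by apply: h; exists M.
  by case: (sM) => mM _ _; apply: mM => //; [apply: sm | apply: sm'].
Qed.

Lemma is_SE x y M : is_S le x y M <-> M = span x y.
Proof.
split=> [[[sM Mx My] leM]|->].
  apply/seteqP; split; last exact: span_sub.
  by apply: leM; split=> //; exact: span_strong.
split=> [|M' [sM' M'x M'y]]; last exact: span_sub.
by split=> //; exact: span_strong.
Qed.

Lemma strong_nested {M M'} x : is_strong_module le M -> is_module le M' ->
  M x -> M' x -> M' `<=` M \/ M `<=` M'.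
Proof.
move=> [_ _ sM] mM' Mx M'x; case: (sM _ mM') => [d|?|?]; [|by left|by right].
by have : (M' `&` M) x by []; rewrite d.
Qed.

(** Order-reversing maps are included because inversion in an ordered group is one. Bijectivity is
    supplied separately, by an inverse [g]. *)
Definition symmetry (f : T -> T) :=
  (forall x y, le (f x) (f y) <-> le x y) \/
  (forall x y, le (f x) (f y) <-> le y x).

Lemma module_preimage f M : symmetry f -> is_module le M ->
  is_module le (f @^-1` M).
Proof.
move=> fle mM w m m' /= nMw Mm Mm'.
have := mM (f w) (f m) (f m') nMw Mm Mm'.
by case: fle => fle; rewrite !fle; tauto.
Qed.

Section Symmetry.
Variables (f g : T -> T).
Hypotheses (fle : symmetry f) (fK : cancel f g) (gK : cancel g f).

Lemma symmetry_inverse : symmetry g.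
Proof. by case: fle => h; [left|right] => x y; rewrite -h !gK. Qed.

Lemma strong_preimage M : is_strong_module le M ->
  is_strong_module le (f @^-1` M).
Proof.
move=> [mM [x Mx] sM]; split; first exact: module_preimage.
  by exists (g x); rewrite /= gK.
move=> M' mM'; have := sM _ (module_preimage symmetry_inverse mM').
case=> [d|s|s].
- apply: Or31; rewrite -subset0 => z [M'z Mz].
  have : (g @^-1` M' `&` M) (f z) by split; rewrite //= fK.
  by rewrite d.
- by apply: Or32 => z M'z; apply: s; rewrite /= fK.
- by apply: Or33 => z /s; rewrite /= fK.
Qed.

Lemma span_image x y z : span x y z -> span (f x) (f y) (f z).
Proof.
by move=> sz M sM Mx My; apply: (sz (f @^-1` M)) => //; apply: strong_preimage.
Qed.

End Symmetry.
End Span.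

(** * Components of a graph without induced four-vertex paths, as strong modules *)

(* [e] stands for either comparability or incomparability; the two cases are
   exchanged by complementation, which preserves the absence of induced paths
   on four vertices. *)
Section Separation.
Variables (T : Type) (le e : T -> T -> Prop).

Let co u v := u <> v /\ ~ e u v.

Hypothesis eC : forall u v, e u v -> e v u.
Hypothesis eP4 : forall a b c d,
  e a b -> e b c -> e c d -> co a c -> co a d -> b <> d -> e b d.
Hypothesis e_module : forall M w m m',
  is_module le M -> ~ M w -> M m -> M m' -> e w m -> e w m'.
Hypothesis e_direction : forall z w u v,
  e u v -> co z u -> co z v -> w <> u -> w <> v ->
  (e w u <-> e w v) -> (e w u -> e w z) ->
  (le w u <-> le w v) /\ (le u w <-> le v w).

Variables x y z : T.
Hypotheses (exy : e x y) (zx : co z x) (zy : co z y).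

(** The [e]-component of [x] among the elements [co]-related to [z], written as the smallest set
    closed under such steps, which yields the induction principle [D_ind]. *)
Let D : set T := [set u | forall E : set T,
  E x -> (forall v w, E v -> co z w -> e v w -> E w) -> E u].

Let Dx : D x. Proof. by []. Qed.

Let D_step v w : D v -> co z w -> e v w -> D w.
Proof. by move=> Dv zw vw E Ex Es; apply: (Es v) => //; apply: Dv. Qed.

Let D_ind (E : set T) : E x ->
  (forall v w, D v -> D w -> E v -> e v w -> E w) -> D `<=` E.
Proof.
move=> Ex Es u Du; suff [] : (D `&` E) u by [].
apply: (Du (D `&` E)) => // v w [Dv Ev] zw vw.
have Dw := D_step Dv zw vw.
by split=> //; apply: (Es v).
Qed.

Let D_co u : D u -> co z u.
Proof. by move=> Du; exact: (Du (co z) zx (fun _ _ _ h _ => h)). Qed.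

(** A neighbour of the component that is [co]-related to [z] would have been absorbed by it. *)
Let outside w u : ~ D w -> D u -> e w u -> e w z.
Proof.
move=> nDw Du wu; apply: contrapT => nwz; apply: nDw.
apply: (D_step Du) => //; last exact: eC.
split; last by move/eC.
by move=> zw; subst w; case: (D_co Du).
Qed.

(** If [w] is outside and adjacent to [u], then z, w, u, v is a path for every edge u, v of the
    component; [z] is adjacent to neither [u] nor [v], so [w] must be adjacent to [v]. Then
    [e_direction] upgrades adjacency to the order itself, and connectedness spreads the conclusion
    from [x]. *)
Let D_module : is_module le D.
Proof.
apply: (@module_from_base _ _ _ x) => w u nDw; move: u.
have edge u v : D u -> D v -> e u v -> e w u -> e w v.
  move=> Du Dv uv wu; apply: (eP4 (eC (outside nDw Du wu)) wu uv).
  - exact: D_co.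
  - exact: D_co.
  - by move=> wv; apply: nDw; rewrite wv.
apply: D_ind => // u v Du Dv [IHl IHr] uv.
have [] := e_direction (z := z) (w := w) uv (D_co Du) (D_co Dv); try tauto.
- by move=> wu; apply: nDw; rewrite wu.
- by move=> wv; apply: nDw; rewrite wv.
- split; first exact: edge.
  by apply: edge => //; apply: eC.
- exact: outside.
Qed.

(** Let a module [M] meet the component and contain some [q] outside it. If an edge u, v of the
    component left [M] at [v], then [q] would be adjacent to [v], hence to [z] and to [u]. This
    forces [z] into [M], and then [v], adjacent to [u], would be adjacent to [z]. So [M] swallows
    the whole component. *)
Let D_strong : is_strong_module le D.
Proof.
split=> //; first by exists x.
move=> M mM.
have [[p [Mp Dp]]|dM] := EM (M `&` D !=set0); last first.
  by apply: Or31; rewrite -subset0 => p Mp; apply: dM; exists p.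
have [sM|/existsNP[q /not_implyP[Mq nDq]]] := EM (M `<=` D); first exact: Or32.
have edge u v : D u -> D v -> e u v -> M u -> M v.
  move=> Du Dv uv Mu; apply: contrapT => nMv.
  have vq : e v q by apply: (e_module mM nMv Mu Mq); apply: eC.
  have qz : e q z by apply: outside (eC vq).
  have qu : e q u by apply: (e_module D_module nDq Dv Du); apply: eC.
  have Mz : M z.
    apply: contrapT => nMz; case: (D_co Du) => _; apply.
    by apply: (e_module mM nMz Mq Mu); apply: eC.
  case: (D_co Dv) => _; apply; apply: eC.
  by apply: (e_module mM nMv Mu Mz); apply: eC.
have Mx : M x.
  suff: D `<=` [set u | M u -> M x] by move=> /(_ _ Dp); apply.
  apply: D_ind => // v w Dv Dw IH vw Mw; apply: IH.
  by apply: (edge w v) => //; apply: eC.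
by apply: Or33; apply: D_ind => // v w Dv Dw Mv vw; apply: (edge v w).
Qed.

(** The component of [x] is a strong module containing [y], and [z], not being [co]-related to
    itself, is no member of it. *)
Lemma span_separated : ~ span le x y z.
Proof.
move=> /(_ D D_strong Dx (D_step Dx zy exy)) /D_co[]; exact.
Qed.

End Separation.

(** * N-free posets: which points S(x, y) can contain *)

Section Poset.
Variables (T : eqType) (le : T -> T -> Prop).
Hypotheses (le_po : partial_order_on setT le) (leN : N_free le).

Lemma comparableC x y : comparable le x y -> comparable le y x.
Proof. by rewrite /comparable; tauto. Qed.

Lemma po_refl x : le x x. Proof. by case: le_po => h _ _; apply: h. Qed.

Lemma po_anti x y : le x y -> le y x -> x = y.
Proof. by case: le_po => _ h _; apply: h. Qed.

Lemma po_trans y x z : le x y -> le y z -> le x z.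
Proof. by case: le_po => _ _ h; apply: h. Qed.

Lemma not_comparable x y : x <> y -> ~ comparable le x y ->
  incomparable le x y.
Proof.
by move=> xy nc; split=> l; apply: nc; [left|right]; split=> //; apply: nesym.
Qed.

Lemma incomparable_neq x y : incomparable le x y -> x <> y.
Proof. by move=> [nxy _] xy; apply: nxy; rewrite xy; apply: po_refl. Qed.

Lemma incomparableN x y : incomparable le x y -> ~ comparable le x y.
Proof. by case=> nxy nyx [[]|[]]. Qed.

Lemma incomparableC x y : incomparable le x y -> incomparable le y x.
Proof. by case. Qed.

(** Two consecutive comparabilities in the same direction would compose to a forbidden one. So the
    directions along the path alternate, and the path is an N read from one end or the other. *)
Lemma N_free_no_path a b c d :
  comparable le a b -> comparable le b c -> comparable le c d ->
  incomparable le a c -> incomparable le b d -> ~ incomparable le a d.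
Proof.
have N u v w t : strict le u v -> strict le w v -> strict le w t ->
    incomparable le u w -> incomparable le v t -> ~ incomparable le u t.
  move=> uv wv wt uw vt ut.
  have nuv := uv.2; have nwv := wv.2; have nwt := wt.2.
  have nuw := incomparable_neq uw; have nvt := incomparable_neq vt.
  have nut := incomparable_neq ut.
  have irr p : ~ strict le p p by case.
  have asym p q : strict le p q -> ~ strict le q p.
    by move=> [pq npq] [qp _]; apply: npq; apply: po_anti.
  have inc p q : incomparable le p q -> ~ strict le p q by move=> [? _] [].
  have inc' p q : incomparable le p q -> ~ strict le q p by move=> [_ ?] [].
  have neq (p q : T) : p <> q -> (p == q) = false by move/eqP/negbTE.
  have nvu := nesym nuv; have nvw := nesym nwv; have ntw := nesym nwt.
  have nwu := nesym nuw; have ntv := nesym nvt; have ntu := nesym nut.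
  apply: (leN (a := u) (b := v) (c := w) (d := t)).
    by rewrite /= !inE !neq.
  move=> p q; rewrite !inE => /or4P[]/eqP-> /or4P[]/eqP->;
    rewrite !xpair_eqE ?eqxx ?neq //=; split=> // h; exfalso; revert h;
    by [apply: irr | apply: asym | apply: inc | apply: inc'].
move=> [ab|ba] [bc|cb] [cd|dc] ac bd ad;
  try by case: ac => nac nca; first
    [ apply: nac; apply: po_trans ab.1 bc.1
    | apply: nca; apply: po_trans cb.1 ba.1 ].
- exact: N ab cb cd ac bd ad.
- by case: bd => _ ndb; apply: ndb; apply: po_trans dc.1 cb.1.
- by case: bd => nbd _; apply: nbd; apply: po_trans bc.1 cd.1.
- apply: (N d c b a) => //; exact: incomparableC.
Qed.

Lemma module_comparable M w m m' : is_module le M -> ~ M w -> M m -> M m' ->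
  comparable le w m -> comparable le w m'.
Proof.
move=> mM nMw Mm Mm' c; have [l r] := mM _ _ _ nMw Mm Mm'.
have wm' : w <> m' by move=> wm'; apply: nMw; rewrite wm'.
case: c => -[c _]; [left|right]; split; try tauto.
exact: nesym.
Qed.

Lemma module_incomparable M w m m' : is_module le M -> ~ M w -> M m -> M m' ->
  incomparable le w m -> incomparable le w m'.
Proof.
move=> mM nMw Mm Mm'; have := mM _ _ _ nMw Mm Mm'.
by rewrite /incomparable; tauto.
Qed.

Lemma span_comparable x y z : comparable le x y -> span le x y z ->
  z = x \/ z = y \/ comparable le z x \/ comparable le z y.
Proof.
move=> xy sz; apply: contrapT => h.
apply: (@span_separated _ le (comparable le)) sz => //; try (by split; tauto).
- exact: comparableC.
- move=> a b c d ab bc cd [nac ac] [nad ad] nbd; apply: contrapT => bd.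
  by apply: (N_free_no_path ab bc cd); apply: not_comparable.
- exact: module_comparable.
(* The real case has [w] comparable to [u], [v] and [z]. If [u] and [v] were on opposite sides of
   [w], then [z], being above or below [w], would be comparable to one of them by transitivity. *)
move=> {x y xy h} {}z w u v uv [nzu zu] [nzv zv] wu wv wuv wz.
have [cu|ncu] := EM (comparable le w u); last first.
  have [? ?] := not_comparable wu ncu.
  have [] : incomparable le w v by apply: not_comparable => //; tauto.
  by tauto.
have cv : comparable le w v by tauto.
have {wz} := wz cu => cz.
have [nlzu nluz] := not_comparable nzu zu.
have [nlzv nlvz] := not_comparable nzv zv.
have tr := po_trans.
case: cz cu cv => -[cz nz] [[cu nu]|[cu nu]] [[cv nv]|[cv nv]];
  have anti := @po_anti; split; split=> l; try done;
  exfalso; eauto.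
Qed.

Lemma span_incomparable x y z : incomparable le x y -> span le x y z ->
  z = x \/ z = y \/ incomparable le z x \/ incomparable le z y.
Proof.
move=> xy sz; apply: contrapT => h.
apply: (@span_separated _ le (incomparable le)) sz => //; try (by split; tauto).
- exact: incomparableC.
- move=> a b c d ab bc cd [nac ac] [nad ad] nbd; apply: contrapT => bd.
  have co p q : p <> q -> ~ incomparable le p q -> comparable le p q.
    by move=> npq npq'; apply: contrapT => /(not_comparable npq).
  (* The complement of the path a, b, c, d is the path c, a, d, b. *)
  apply: (@N_free_no_path c a d b) => //; try exact: incomparableC.
  + by apply/comparableC/co.
  + exact: co.
  + by apply: co => [/esym|/incomparableC].
- exact: module_incomparable.
(* If [w] is comparable to [u] and [v], they lie on the same side of it, since otherwise they would
   be comparable through [w]. *)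
move=> {x y xy h} {}z w u v [nuv nvu] _ _ wu wv wuv _.
have [cu|ncu] := EM (incomparable le w u).
  by have := wuv; have := cu; rewrite /incomparable; tauto.
have cu : comparable le w u by apply: contrapT => /(not_comparable wu).
have cv : comparable le w v by apply: contrapT => /(not_comparable wv); tauto.
have tr := po_trans.
case: cu cv => -[cu nu] [[cv nv]|[cv nv]];
  have anti := @po_anti; split; split=> l; try done;
  exfalso; eauto.
Qed.

End Poset.

(** * Conjugates, cosets and quotients of subgroups *)

Section Subgroups.
Variable G : groupType.
Implicit Types (H K N X Y : set G) (F : set (set G)).

Definition group_norm := (@mulgA G, @invgM G, @invgK G, @mulg1 G,
  @mul1g G, @invg1 G, @mulgV G, @mulVg G, @mulgK G, @mulgVK G).

Lemma set_conjE g X x : set_conj g X x <-> X (x ^ g^-1).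
Proof.
split=> [[y Xy <-]|Xx]; first by rewrite conjgK.
by exists (x ^ g^-1) => //; rewrite conjgKV.
Qed.

Lemma set_conjJ g X x : set_conj g X (x ^ g) <-> X x.
Proof. by rewrite set_conjE conjgK. Qed.

Lemma set_conjK g X : set_conj g^-1 (set_conj g X) = X.
Proof. by apply/seteqP; split=> x; rewrite !set_conjE invgK conjgK. Qed.

Lemma set_conj_sub g X Y : X `<=` Y -> set_conj g X `<=` set_conj g Y.
Proof. by move=> XY x; rewrite !set_conjE; apply: XY. Qed.

Lemma set_conj_proper g X Y : X `<` Y -> set_conj g X `<` set_conj g Y.
Proof.
move=> [XY YX]; split; first exact: set_conj_sub.
by move=> /(set_conj_sub (g := g^-1)); rewrite !set_conjK.
Qed.

Lemma lcoset_ofE x N y : lcoset_of x N y <-> N (x^-1 * y).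
Proof.
split=> [[z Nz <-]|Nxy]; first by rewrite mulKg.
by exists (x^-1 * y) => //; rewrite mulVKg.
Qed.

Lemma lcoset_of1 N : lcoset_of 1 N = N.
Proof. by apply/seteqP; split=> x; rewrite lcoset_ofE invg1 mul1g. Qed.

Lemma lcoset_of_refl x N : is_subgroup N -> lcoset_of x N x.
Proof. by move=> [N1 _ _]; rewrite lcoset_ofE mulVg. Qed.

Lemma subgroupV N x : is_subgroup N -> N x^-1 -> N x.
Proof. by move=> [_ _ NV] /NV; rewrite invgK. Qed.

Lemma subgroupMl N x y : is_subgroup N -> N x -> N (x * y) <-> N y.
Proof.
move=> [_ NM NV] Nx; split=> Ny; last exact: NM.
by rewrite -(mulKg x y); apply: NM => //; apply: NV.
Qed.

Lemma subgroupMr N x y : is_subgroup N -> N x -> N (y * x) <-> N y.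
Proof.
move=> [_ NM NV] Nx; split=> Ny; last exact: NM.
by rewrite -(mulgK x y); apply: NM => //; apply: NV.
Qed.

Lemma subgroup_divC N x y : is_subgroup N -> N (x^-1 * y) -> N (y^-1 * x).
Proof. by move=> [_ _ NV] /NV; rewrite invgM invgK. Qed.

Lemma lcoset_of_eq x y N : is_subgroup N ->
  lcoset_of x N = lcoset_of y N <-> N (x^-1 * y).
Proof.
move=> sN; split=> [e|Nxy].
  by have := lcoset_of_refl y sN; rewrite -e lcoset_ofE.
have Nyx := subgroup_divC sN Nxy.
apply/seteqP; split=> z; rewrite !lcoset_ofE.
  by move/(subgroupMl _ sN Nyx); rewrite mulgA mulgK.
by move/(subgroupMl _ sN Nxy); rewrite mulgA mulgK.
Qed.

Lemma lcoset_of_memP x N : is_subgroup N -> lcoset_of x N = N <-> N x.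
Proof.
move=> sN; have := lcoset_of_eq x 1 sN; rewrite lcoset_of1 mulg1 => ->.
by split; [exact: subgroupV | case: sN => _ _; apply].
Qed.

Lemma normal_conj N H x h : is_normal_in N H -> is_subgroup H -> H h ->
  N (x ^ h) <-> N x.
Proof.
move=> [_ _ nN] [_ _ HV] Hh; split=> [Nx|Nx]; last exact: nN.
by rewrite -(conjgK h x); apply: nN => //; apply: HV.
Qed.

Lemma set_mul_lcoset N H x y : is_subgroup H -> is_normal_in N H -> H y ->
  set_mul (lcoset_of x N) (lcoset_of y N) = lcoset_of (x * y) N.
Proof.
move=> sH nNH Hy; have [sN _ _] := nNH; have [N1 NM _] := sN.
apply/seteqP; split=> z.
  move=> [a]; rewrite lcoset_ofE => Na [b]; rewrite lcoset_ofE => Nb <-.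
  rewrite lcoset_ofE.
  have -> : (x * y)^-1 * (a * b) = (x^-1 * a) ^ y * (y^-1 * b).
    by rewrite conjgE !group_norm.
  by apply: NM => //; apply/(normal_conj _ nNH sH Hy).
rewrite lcoset_ofE => Nz; exists x; first exact: lcoset_of_refl.
exists (x^-1 * z); last by rewrite mulVKg.
by rewrite lcoset_ofE; move: Nz; rewrite invgM mulgA.
Qed.

Lemma set_conj_lcoset g x N :
  set_conj g (lcoset_of x N) = lcoset_of (x ^ g) (set_conj g N).
Proof.
apply/seteqP; split=> z; rewrite set_conjE !lcoset_ofE set_conjE;
  by rewrite conjMg conjVg conjgK.
Qed.

Lemma quotient_conj g H N X : quotient H N X ->
  quotient (set_conj g H) (set_conj g N) (set_conj g X).
Proof.
move=> [x Hx <-]; exists (x ^ g); first by rewrite set_conjJ.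
by rewrite set_conj_lcoset.
Qed.

(** * The subgroup H^- in a chain of subgroups *)

Section Lower.
Variable F : set (set G).
Hypotheses (Fsub : forall H, F H -> is_subgroup H) (Ftot : total_on F subset).

Lemma subset_lower K H : F K -> K `<` H -> K `<=` lower F H.
Proof. by move=> FK KH x Kx; right; exists K. Qed.

Lemma lower1 H : lower F H 1. Proof. by left. Qed.

Lemma lower_sub H : F H -> lower F H `<=` H.
Proof.
move=> FH x [->|[K [FK [KH _]]]]; first by case: (Fsub FH).
exact: KH.
Qed.

(** Two factors lie in two members of a chain, and the larger member contains their product. *)
Lemma lower_subgroup H : is_subgroup (lower F H).
Proof.
split; first exact: lower1.
- move=> x y [->|[K [FK KH] Kx]]; first by rewrite mul1g.
  move=> [->|[L [FL LH] Ly]]; first by rewrite mulg1; right; exists K.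
  have [KL|LK] := Ftot FK FL.
    apply: (subset_lower FL LH); case: (Fsub FL) => _ FM _.
    by apply: FM => //; apply: KL.
  apply: (subset_lower FK KH); case: (Fsub FK) => _ FM _.
  by apply: FM => //; apply: LK.
- move=> x [->|[K [FK KH] Kx]]; first by rewrite invg1; left.
  by apply: (subset_lower FK KH); case: (Fsub FK) => _ _; apply.
Qed.

Lemma level_total H K : F H -> F K -> H `<=` K \/ K `<` H.
Proof.
move=> FH FK; have [HK|HK] := EM (H `<=` K); first by left.
by right; split=> //; case: (Ftot FH FK).
Qed.

(** A strictly smaller level containing [g] would be part of H^-. Together with [least_not_lower],
    this lets membership in H but not in H^- stand for being of level H, when [g] is not 1. *)
Lemma level_least H g : F H -> H g -> ~ lower F H g ->
  least [set K | F K /\ K g] H.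
Proof.
move=> FH Hg ng; split=> // K [FK Kg].
by have [//|KH] := level_total FH FK; case: ng; apply: (subset_lower FK KH).
Qed.

Lemma least_not_lower H g : g <> 1 -> least [set K | F K /\ K g] H ->
  ~ lower F H g.
Proof.
move=> g1 [[FH Hg] lH] [//|[K [FK [_ HK]] Kg]].
by apply: HK; apply: lH.
Qed.

Lemma least_unique H K g : least [set K | F K /\ K g] H ->
  least [set K | F K /\ K g] K -> H = K.
Proof.
by move=> [FH lH] [FK lK]; apply/seteqP; split; [apply: lH|apply: lK].
Qed.

Lemma lower_conj g H : (forall h K, F K -> F (set_conj h K)) ->
  set_conj g (lower F H) = lower F (set_conj g H).
Proof.
move=> FJ; apply/seteqP; split=> x.
  rewrite set_conjE => -[/= /(congr1 (conjg^~ g))|[K [FK KH] Kx]].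
    by rewrite conjgKV conj1g => ->; left.
  right; exists (set_conj g K); last by rewrite set_conjE.
  by split; [apply: FJ | apply: set_conj_proper].
rewrite set_conjE => -[/= ->|[K [FK KH] Kx]]; first by rewrite conj1g; left.
right; exists (set_conj g^-1 K); last by rewrite set_conjE conjgK.
split; first exact: FJ.
by rewrite -(set_conjK g H); apply: set_conj_proper.
Qed.

End Lower.
End Subgroups.

(** * Strong modules in an ordered group *)

Section OrderedGroup.
Variables (G : groupType) (le : G -> G -> Prop).
Hypothesis leG : is_group_order le.
Implicit Types (H K N M X Y : set G).

Let le_po := leG.1.
Let refl := po_refl le_po.
Let anti := po_anti le_po.
Let trans := po_trans le_po.

Lemma le_mul2l a x y : le (a * x) (a * y) <-> le x y.
Proof.
case: leG => _ h; split=> [/(h a^-1 1)|/(h a 1)]; last by rewrite !mulg1.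
by rewrite !group_norm.
Qed.

Lemma le_mul2r a x y : le (x * a) (y * a) <-> le x y.
Proof.
case: leG => _ h; split=> [/(h 1 a^-1)|/(h 1 a)]; last by rewrite !mul1g.
by rewrite !group_norm.
Qed.

Lemma le_inv x y : le x^-1 y^-1 <-> le y x.
Proof.
case: leG => _ h; split=> [/(h y x)|/(h x^-1 y^-1)]; by rewrite !group_norm.
Qed.

Lemma le_conj a x y : le (x ^ a) (y ^ a) <-> le x y.
Proof. by rewrite !conjgE le_mul2l le_mul2r. Qed.

Lemma le_1div x y : le 1 (x^-1 * y) <-> le x y.
Proof. by rewrite -(le_mul2l x) mulg1 mulVKg. Qed.

Lemma le_div1 x y : le (y^-1 * x) 1 <-> le x y.
Proof. by rewrite -(le_mul2l y) mulg1 mulVKg. Qed.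

Lemma mul_symmetry a : symmetry le (mul a).
Proof. by left=> x y; apply: le_mul2l. Qed.

Lemma inv_symmetry : symmetry le (@inv G).
Proof. by right=> x y; apply: le_inv. Qed.

Lemma conj_symmetry a : symmetry le (fun x => x ^ a).
Proof. by left=> x y; apply: le_conj. Qed.

Lemma span_mul a x y z : span le x y z -> span le (a * x) (a * y) (a * z).
Proof.
exact: (span_image (mul_symmetry a) (g := mul a^-1) (mulKg a) (mulVKg a)).
Qed.

Lemma span_inv x y z : span le x y z -> span le x^-1 y^-1 z^-1.
Proof. exact: (span_image inv_symmetry (@invgK G) (@invgK G)). Qed.

Lemma span_conj a x y z : span le x y z -> span le (x ^ a) (y ^ a) (z ^ a).
Proof. exact: (span_image (conj_symmetry a) (conjgK a) (conjgKV a)). Qed.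

Lemma span1_conj a g : set_conj a (span le 1 g) = span le 1 (g ^ a).
Proof.
apply/seteqP; split=> x; rewrite set_conjE => /=.
  by move/(span_conj (a := a)); rewrite conj1g conjgKV.
by move/(span_conj (a := a^-1)); rewrite conj1g conjgK.
Qed.

(* S(1, g) and its image under inversion are nested strong modules, and
   inversion is an involution. *)
Lemma span1_invg g x : span le 1 g x -> span le 1 g x^-1.
Proof.
have sS := span_strong le 1 g.
have sI := strong_preimage inv_symmetry (@invgK G) (@invgK G) sS.
have [mI _ _] := sI.
have I1 : (@inv G @^-1` span le 1 g) 1 by rewrite /= invg1.
have [s|s] := strong_nested sS mI (@span_l _ le 1 g) I1.
  by move=> Sx; apply: s; rewrite /= invgK.
by move/s.
Qed.

(** Translation by [g^-1] carries the pair 1, g to g^-1, 1, and inversion carries that back to g, 1;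
    closure under inversion removes the remaining inverse. *)
Lemma span1_mulVg g x : span le 1 g x -> span le 1 g (g^-1 * x).
Proof.
move/(span_mul (a := g^-1)); rewrite mulg1 mulVg spanC => /span_inv.
by rewrite invg1 invgK => /span1_invg; rewrite invgK.
Qed.

(* For h in S = S(1, g), both h and h * g lie in S, hence so does
   S(h, h * g) = h S. *)
Lemma span1_subgroup g : is_subgroup (span le 1 g).
Proof.
split=> // [h k Sh Sk|]; last exact: span1_invg.
have Shg : span le 1 g (h * g).
  rewrite -(invgK (h * g)) invgM; apply: span1_invg.
  by apply: span1_mulVg; apply: span1_invg.
have := span_mul (a := h) Sk; rewrite mulg1.
by apply: span_sub => //; apply: span_strong.
Qed.

(** All the subgroups share 1, which serves as a common base point for their union. *)
Lemma lower_module F H : (forall K, F K -> is_subgroup K /\ is_module le K) ->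
  is_module le (lower F H).
Proof.
move=> FP; apply: (@module_from_base _ _ _ 1) => w m nw [->//|[K [FK KH] Km]].
have [[K1 _ _] mK] := FP _ FK.
by apply: mK => // Kw; apply: nw; right; exists K.
Qed.

Lemma strict_1inv x : strict le 1 x <-> strict le x^-1 1.
Proof.
rewrite /strict -{1}(invgK x) -{1}(invg1 G) le_inv.
split=> -[l n]; split=> // e; apply: n.
  by rewrite -(invgK x) e invg1.
by rewrite -e invg1.
Qed.

Lemma comparable_positive N H x : is_subgroup N -> is_subgroup H ->
  H x -> ~ N x -> comparable le 1 x ->
  exists y, [/\ H y, ~ N y & strict le 1 y].
Proof.
move=> sN [_ _ HV] Hx nNx [l|l]; first by exists x.
exists x^-1; split; [exact: HV | by move/(subgroupV sN) |].
by rewrite strict_1inv invgK.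
Qed.

(* H modulo N is a chain, and a proper initial segment ending at N is a module
   overlapping M unless M = H. *)
Lemma collapse_comparable N M H g :
  is_subgroup N -> is_module le N -> is_subgroup M -> is_strong_module le M ->
  is_subgroup H -> is_module le H -> M `<=` H -> M g -> ~ N g ->
  (forall x, H x -> ~ N x -> comparable le 1 x) -> H `<=` M.
Proof.
move=> sN mN sM strM sH mH MH Mg nNg HN x Hx; apply: contrapT => nMx.
have [M1 _ _] := sM; have [N1 _ _] := sN; have [H1 _ _] := sH.
have [Nx|nNx] := EM (N x).
  have [NM|MN] := strong_nested strM mN M1 N1; first by apply: nMx; apply: NM.
  by apply: nNg; apply: MN.
have [a [Ha nMa pa]] := comparable_positive sM sH Hx nMx (HN _ Hx nNx).
have [b [Mb nNb pb]] := comparable_positive sN sM Mg nNg (HN _ (MH _ Mg) nNg).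
pose I : set G := [set y | H y /\ (N y \/ strict le y 1)].
have mI : is_module le I.
  apply: (@module_from_base _ _ _ 1) => w m nIw [Hm Im].
  have [Hw|nHw] := EM (H w); last exact: mH.
  have nNw : ~ N w by move=> Nw; apply: nIw; split=> //; left.
  case: Im => [Nm|[m1 nm1]]; first exact: mN.
  have [[w1 nw1]|w1] := HN _ Hw nNw; last by case: nIw; split=> //; right.
  have mw := trans m1 w1.
  split; split=> // l; case: nw1; apply: anti => //.
  exact: trans l m1.
have I1 : I 1 by split=> //; left.
have Ia : I a^-1.
  by case: sH => _ _ HV; split; [apply: HV | right; apply/strict_1inv].
have [IM|MI] := strong_nested strM mI M1 I1.
  by apply: nMa; apply: (subgroupV sM); apply: IM.
by have [_ [//|[b1 nb1]]] := MI _ Mb; apply: nb1; case: pb => ? _; apply: anti.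
Qed.

(* H modulo N is an antichain, so any union of two cosets of N is a module. *)
Lemma collapse_incomparable N M H g :
  is_subgroup N -> is_module le N -> is_subgroup M -> is_strong_module le M ->
  is_subgroup H -> is_module le H -> M `<=` H -> N `<=` H -> M g -> ~ N g ->
  (forall x, H x -> ~ N x -> incomparable le 1 x) -> H `<=` M.
Proof.
move=> sN mN sM strM sH mH MH NH Mg nNg HN x Hx; apply: contrapT => nMx.
have [M1 MM MV] := sM; have [N1 _ NV] := sN; have [H1 HM HV] := sH.
have NM : N `<=` M.
  have [//|MN] := strong_nested strM mN M1 N1.
  by case: nNg; apply: MN.
pose I : set G := N `|` lcoset_of x N.
have mI : is_module le I.
  apply: (@module_from_base _ _ _ 1) => w m nIw Im.
  have [Hw|nHw] := EM (H w); last first.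
    apply: mH => //; case: Im => [|[n Nn <-]]; first exact: NH.
    by apply: HM => //; apply: NH.
  have nNw : ~ N w by move=> Nw; apply: nIw; left.
  case: Im => [Nm|]; first exact: mN.
  rewrite lcoset_ofE => Nm.
  have nxw : ~ N (x^-1 * w) by move=> h; apply: nIw; right; rewrite lcoset_ofE.
  have Hxw : H (x^-1 * w) by apply: HM => //; apply: HV.
  rewrite -(le_mul2l x^-1) -(le_mul2l x^-1 m).
  have [l r] := mN _ _ _ nxw Nm N1.
  have [? ?] := HN _ Hw nNw; have [? ?] := HN _ Hxw nxw.
  tauto.
have I1 : I 1 by left.
have [IM|MI] := strong_nested strM mI M1 I1.
  by apply: nMx; apply: IM; right; apply: lcoset_of_refl.
have [//|] := MI _ Mg; rewrite lcoset_ofE => Nxg; apply: nMx.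
rewrite -(invgK x); apply: (MV); rewrite -(mulgK g x^-1).
by apply: MM; [apply: NM | apply: MV].
Qed.

(** * The quotient order modulo a subgroup that is a module *)

Section CosetOrder.
Variables (N H : set G).
Hypotheses (sN : is_subgroup N) (mN : is_module le N) (sH : is_subgroup H).

(** A translation turns each coset into the module [N], whose members look alike from the other
    coset; so the two representatives are replaced one after the other. *)
Lemma le_coset x y x' y' : ~ N (x^-1 * y) -> N (x^-1 * x') -> N (y^-1 * y') ->
  le x' y' <-> le x y.
Proof.
have [N1 _ NV] := sN.
move=> nxy Nx Ny; have nyx : ~ N (y^-1 * x) by move/(subgroup_divC sN).
have -> : le x' y' <-> le x y'.
  rewrite -(le_mul2l x^-1) -(le_mul2l x^-1 x) mulVg.
  have nxy' : ~ N (x^-1 * y').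
    by move/(subgroupMr _ sN (NV _ Ny)); rewrite !group_norm.
  by have [_] := mN nxy' Nx N1.
rewrite -(le_mul2l y^-1) -(le_mul2l y^-1 _ y) mulVg.
by have [] := mN nyx Ny N1.
Qed.

Lemma quotient_leE x y : quotient_le le (lcoset_of x N) (lcoset_of y N) <->
  N (x^-1 * y) \/ le x y.
Proof.
split=> [[x' [y' []]]|[Nxy|xy]].
- rewrite !lcoset_ofE => Nx Ny l.
  have [|nxy] := EM (N (x^-1 * y)); first by left.
  by right; rewrite -(le_coset nxy Nx Ny).
- exists y, y; split; [by rewrite lcoset_ofE | exact: lcoset_of_refl | by []].
- by exists x, y; split=> //; apply: lcoset_of_refl.
Qed.

Lemma quotient_le_po : partial_order_on (quotient H N) (quotient_le le).
Proof.
split=> [_ [x Hx <-]|_ _ [x Hx <-] [y Hy <-]|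
         _ _ _ [x Hx <-] [y Hy <-] [z Hz <-]].
- by apply/quotient_leE; right.
- rewrite !quotient_leE lcoset_of_eq // => -[//|xy] [/(subgroup_divC sN)//|yx].
  by rewrite (anti xy yx) mulVg; case: sN.
- move=> lxy lyz.
  have [/(lcoset_of_eq _ _ sN) <- //|yz] := iffLR (quotient_leE _ _) lyz.
  have [/(lcoset_of_eq _ _ sN) -> //|xy] := iffLR (quotient_leE _ _) lxy.
  by apply/quotient_leE; right; apply: trans xy yz.
Qed.

(** By translation, the order between two cosets is decided at 1. This and [quotient_equality]
    reduce the types of levels to how the elements of H outside N compare with 1. *)
Lemma quotient_total : total_order_on (quotient H N) (quotient_le le) <->
  forall x, H x -> ~ N x -> comparable le 1 x.
Proof.
have [N1 NM NV] := sN; have [H1 HM HV] := sH.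
split=> [[_ tot] x Hx nNx|c].
  have x1 : 1 <> x by move=> x1; apply: nNx; rewrite -x1.
  have q y : H y -> quotient H N (lcoset_of y N) by exists y.
  have := tot _ _ (q 1 H1) (q x Hx).
  rewrite !quotient_leE invg1 mul1g mulg1 => -[[//|l]|[/(subgroupV sN)//|l]].
    by left.
  by right; split=> //; apply: nesym.
split; first exact: quotient_le_po.
move=> _ _ [x Hx <-] [y Hy <-]; rewrite !quotient_leE.
have [Nxy|nxy] := EM (N (x^-1 * y)); first by left; left.
have [[l _]|[l _]] := c (x^-1 * y) (HM _ _ (HV _ Hx) Hy) nxy.
  by left; right; apply/le_1div.
by right; right; apply/le_div1.
Qed.

Lemma quotient_equality : equality_order_on (quotient H N) (quotient_le le) <->
  forall x, H x -> ~ N x -> incomparable le 1 x.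
Proof.
have [N1 NM NV] := sN; have [H1 HM HV] := sH.
split=> [eqo x Hx nNx|c].
  have q y : H y -> quotient H N (lcoset_of y N) by exists y.
  have := eqo _ _ (q 1 H1) (q x Hx); have := eqo _ _ (q x Hx) (q 1 H1).
  rewrite !quotient_leE !lcoset_of_eq // invg1 mul1g mulg1.
  have nV : ~ N x^-1 by move/(subgroupV sN).
  by rewrite /incomparable; tauto.
move=> _ _ [x Hx <-] [y Hy <-]; rewrite quotient_leE lcoset_of_eq //.
split; last by left.
move=> [//|/le_1div l]; apply: contrapT => nxy.
by have [] := c (x^-1 * y) (HM _ _ (HV _ Hx) Hy) nxy.
Qed.

End CosetOrder.

(** * The canonical chain *)

Let V := canonical_levels le.
Let low := lower V.

Lemma canonical_levelP H : V H <-> exists2 g, g <> 1 & H = span le 1 g.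
Proof. by split=> -[g g1 /is_SE HS]; exists g. Qed.

Lemma canonical_span g : g <> 1 -> V (span le 1 g).
Proof. by move=> g1; apply/canonical_levelP; exists g. Qed.

Lemma canonical_subgroup H : V H -> is_subgroup H.
Proof. by move=> /canonical_levelP[g _ ->]; apply: span1_subgroup. Qed.

Lemma canonical_strong H : V H -> is_strong_module le H.
Proof. by move=> /canonical_levelP[g _ ->]; apply: span_strong. Qed.

Lemma canonical_module H : V H -> is_module le H.
Proof. by move=> /canonical_strong[]. Qed.

Lemma canonical_total : total_on V subset.
Proof.
move=> H K VH VK; have [H1 _ _] := canonical_subgroup VH.
have [K1 _ _] := canonical_subgroup VK.
have := strong_nested (canonical_strong VH) (canonical_module VK) H1 K1.
by case; [right | left].
Qed.

Lemma canonical_least g : g <> 1 ->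
  least [set K | V K /\ K g] (span le 1 g).
Proof.
move=> g1; split=> [|K [VK Kg]]; first by split=> //; apply: canonical_span.
apply: span_sub => //; first exact: canonical_strong.
by case: (canonical_subgroup VK).
Qed.

Lemma canonical_lower_subgroup H : is_subgroup (low H).
Proof. exact: lower_subgroup canonical_subgroup canonical_total H. Qed.

Lemma canonical_lower_module H : is_module le (low H).
Proof.
apply: lower_module => K VK; split; first exact: canonical_subgroup.
exact: canonical_module.
Qed.

Lemma canonical_lower_sub H : V H -> low H `<=` H.
Proof. exact: lower_sub canonical_subgroup H. Qed.

Lemma not_low_neq1 H x : ~ low H x -> x <> 1.
Proof. by move=> nHx x1; apply: nHx; rewrite x1; apply: lower1. Qed.

(** Both sides are the least level of [x]. Hence any two elements of a level outside its lower part
    lie in each other's span with 1. *)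
Lemma canonical_levelE H x : V H -> H x -> ~ low H x -> H = span le 1 x.
Proof.
move=> VH Hx nHx; apply: (@least_unique _ V _ _ x).
  exact: (level_least canonical_total).
exact/canonical_least/not_low_neq1/nHx.
Qed.

Lemma canonical_conj h H : V H -> V (set_conj h H).
Proof.
move=> /canonical_levelP[g g1 ->]; rewrite span1_conj; apply: canonical_span.
by move=> /(congr1 (conjg^~ h^-1)); rewrite conjgK conj1g.
Qed.

Lemma canonical_low_conj h H : set_conj h (low H) = low (set_conj h H).
Proof. by apply: lower_conj => *; apply: canonical_conj. Qed.

Lemma canonical_witness H : V H -> exists g, H g /\ ~ low H g.
Proof.
move=> /canonical_levelP[g g1 ->]; exists g; split=> //.
exact: least_not_lower (canonical_least g1).
Qed.

Lemma canonical_proper H : V H -> low H `<` H.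
Proof.
move=> VH; split; first exact: canonical_lower_sub.
by have [g [Hg nHg]] := canonical_witness VH => /(_ _ Hg).
Qed.

Lemma set_conj_subgroup H h : is_subgroup H -> H h -> set_conj h H = H.
Proof.
move=> [_ HM HV] Hh; apply/seteqP; split=> x; rewrite set_conjE.
  move=> Hx; rewrite -(conjgKV h x) conjgE.
  by apply: (HM); [apply: HV | apply: HM].
move=> Hx; rewrite conjgE invgK.
by apply: (HM) => //; apply: HM => //; apply: HV.
Qed.

(** Conjugation permutes the levels, and conjugation by an element of H fixes H, hence also the
    union of the levels below it. *)
Lemma canonical_normal H : V H -> is_normal_in (low H) H.
Proof.
move=> VH; split; first exact: canonical_lower_subgroup.
  exact: canonical_lower_sub.
move=> h x Hh; rewrite -(set_conjJ h) canonical_low_conj.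
by rewrite (set_conj_subgroup (canonical_subgroup VH) Hh).
Qed.

Lemma canonical_quotient_total H : V H ->
  total_order_on (canonical_quotient le H) (quotient_le le) <->
  forall x, H x -> ~ low H x -> comparable le 1 x.
Proof.
move=> VH; apply: quotient_total; [exact: canonical_lower_subgroup |
  exact: canonical_lower_module | exact: canonical_subgroup].
Qed.

Lemma canonical_quotient_equality H : V H ->
  equality_order_on (canonical_quotient le H) (quotient_le le) <->
  forall x, H x -> ~ low H x -> incomparable le 1 x.
Proof.
move=> VH; apply: quotient_equality; [exact: canonical_lower_subgroup |
  exact: canonical_lower_module | exact: canonical_subgroup].
Qed.

(** * Types of the canonical levels of an N-free order, and reducedness *)

Hypothesis leN : N_free le.

(** Since [h] lies in S(1, g) and is not comparable to 1, it is comparable to [g]. Since [g] lies in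
    S(1, h), it is incomparable to 1 or to [h]. Both options are excluded. *)
Lemma canonical_level_pure H g h : V H -> H g -> ~ low H g -> H h ->
  ~ low H h -> comparable le 1 g -> ~ incomparable le 1 h.
Proof.
move=> VH Hg ng Hh nh cg ih.
have g1 := not_low_neq1 ng; have h1 := not_low_neq1 nh.
have ch := incomparableN (incomparableC ih).
have gh : g <> h by move=> gh; apply: ch; rewrite -gh; apply: comparableC.
have Sh : span le 1 g h by rewrite -(canonical_levelE VH Hg ng).
have Sg : span le 1 h g by rewrite -(canonical_levelE VH Hh nh).
have [//|[/esym//|[//|chg]]] := span_comparable le_po leN cg Sh.
have [//|[//|[ig|ig]]] := span_incomparable le_po leN ih Sg.
  by apply: (incomparableN (incomparableC ig)).
by apply: (incomparableN (incomparableC ig)).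
Qed.

Lemma canonical_dichotomy H : V H ->
  (forall x, H x -> ~ low H x -> comparable le 1 x) \/
  (forall x, H x -> ~ low H x -> incomparable le 1 x).
Proof.
move=> VH; have [g [Hg ng]] := canonical_witness VH.
have [cg|ncg] := EM (comparable le 1 g); [left|right] => x Hx nx.
  apply: contrapT => ncx; apply: (canonical_level_pure VH Hg ng Hx nx cg).
  by apply: not_comparable => //; apply/nesym/not_low_neq1/nx.
apply: not_comparable; first exact/nesym/not_low_neq1/nx.
move=> cx; apply: (canonical_level_pure VH Hx nx Hg ng cx).
by apply: not_comparable => //; apply/nesym/not_low_neq1/ng.
Qed.

Lemma canonical_exclusive H : V H ->
  (forall x, H x -> ~ low H x -> comparable le 1 x) ->
  ~ (forall x, H x -> ~ low H x -> incomparable le 1 x).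
Proof.
move=> VH c i; have [g [Hg ng]] := canonical_witness VH.
exact: incomparableN (i g Hg ng) (c g Hg ng).
Qed.

(** The level of [x] is contained in [H] and, as [x] is outside K^-, is not strictly below [K]; the
    chain property leaves three positions. *)
Lemma canonical_between K H x : V K -> V H -> K `<` H -> H x -> ~ low K x ->
  [\/ span le 1 x = K, span le 1 x = H |
      K `<` span le 1 x /\ span le 1 x `<` H].
Proof.
move=> VK VH KH Hx nKx; have VS := canonical_span (not_low_neq1 nKx).
have SH : span le 1 x `<=` H.
  by case: (canonical_least (not_low_neq1 nKx)) => _; apply.
have [KS|SK] := level_total canonical_total VK VS; last first.
  by case: nKx; right; exists (span le 1 x).
have [HS|nHS] := EM (H `<=` span le 1 x).
  by apply: Or32; apply/seteqP.
have [SK|nSK] := EM (span le 1 x `<=` K).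
  by apply: Or31; apply/seteqP.
by apply: Or33.
Qed.

(** If no such level existed, every element of [H] outside K^- would be comparable to 1, and
    [collapse_comparable], applied to K^-, [K] and [H], would give [H] inside [K]. The incomparable
    case below is parallel. *)
Lemma canonical_reduced_comparable K H : V K -> V H -> K `<` H ->
  (forall x, K x -> ~ low K x -> comparable le 1 x) ->
  (forall x, H x -> ~ low H x -> comparable le 1 x) ->
  exists L, [/\ V L, K `<` L, L `<` H &
    forall x, L x -> ~ low L x -> incomparable le 1 x].
Proof.
move=> VK VH KH cK cH; apply: contrapT => nL; case: (KH) => _; apply.
have [k [Kk nk]] := canonical_witness VK.
apply: (@collapse_comparable (low K) K H k) => //.
- exact: canonical_lower_subgroup.
- exact: canonical_lower_module.
- exact: canonical_subgroup.
- exact: canonical_strong.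
- exact: canonical_subgroup.
- exact: canonical_module.
- by case: KH.
move=> x Hx nx; have x1 := not_low_neq1 nx.
have nSx := least_not_lower x1 (canonical_least x1).
case: (canonical_between VK VH KH Hx nx) => [S|S|[KS SH]].
- by apply: cK; rewrite -?S.
- by apply: cH; rewrite -?S.
have VS := canonical_span x1.
have [c|i] := canonical_dichotomy VS; first exact: c.
by case: nL; exists (span le 1 x).
Qed.

Lemma canonical_reduced_incomparable K H : V K -> V H -> K `<` H ->
  (forall x, K x -> ~ low K x -> incomparable le 1 x) ->
  (forall x, H x -> ~ low H x -> incomparable le 1 x) ->
  exists L, [/\ V L, K `<` L, L `<` H &
    forall x, L x -> ~ low L x -> comparable le 1 x].
Proof.
move=> VK VH KH cK cH; apply: contrapT => nL; case: (KH) => _; apply.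
have [k [Kk nk]] := canonical_witness VK.
apply: (@collapse_incomparable (low K) K H k) => //.
- exact: canonical_lower_subgroup.
- exact: canonical_lower_module.
- exact: canonical_subgroup.
- exact: canonical_strong.
- exact: canonical_subgroup.
- exact: canonical_module.
- by case: KH.
- by case: KH => sKH _; apply: subset_trans (canonical_lower_sub VK) sKH.
move=> x Hx nx; have x1 := not_low_neq1 nx.
have nSx := least_not_lower x1 (canonical_least x1).
case: (canonical_between VK VH KH Hx nx) => [S|S|[KS SH]].
- by apply: cK; rewrite -?S.
- by apply: cH; rewrite -?S.
have VS := canonical_span x1.
have [c|i] := canonical_dichotomy VS; last exact: i.
by case: nL; exists (span le 1 x).
Qed.

(** * The coloured chain of an N-free group order *)

Definition chain_of_order : chain_data G := ChainData
  [set H | V H /\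
     total_order_on (canonical_quotient le H) (quotient_le le)]
  [set H | V H /\
     equality_order_on (canonical_quotient le H) (quotient_le le)]
  (fun H X Y => [/\ V H, canonical_quotient le H X, canonical_quotient le H Y
     & quotient_le le X Y]).

Let c := chain_of_order.

Lemma chain_typeC H : typeC c H <->
  V H /\ forall x, H x -> ~ low H x -> comparable le 1 x.
Proof.
by split=> -[VH h]; split=> //; apply/canonical_quotient_total.
Qed.

Lemma chain_typeA H : typeA c H <->
  V H /\ forall x, H x -> ~ low H x -> incomparable le 1 x.
Proof.
by split=> -[VH h]; split=> //; apply/canonical_quotient_equality.
Qed.

Lemma chain_levels : levels c = V.
Proof.
apply/seteqP; split=> [H [[]|[]]|H VH] //.
have [h|h] := canonical_dichotomy VH; [left|right].
  exact/chain_typeC.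
exact/chain_typeA.
Qed.

Lemma chain_two_coloured : is_two_coloured_chain c.
Proof.
rewrite /is_two_coloured_chain /level_quotient chain_levels; split=> //.
- exact: canonical_subgroup.
- exact: canonical_total.
- rewrite -subset0 => H [/chain_typeC[VH h] /chain_typeA[_]].
  exact: canonical_exclusive.
- by move=> H X Y [].
Qed.

Lemma quotient_le_conj g X Y : quotient_le le X Y ->
  quotient_le le (set_conj g X) (set_conj g Y).
Proof.
move=> [x [y [Xx Yy xy]]]; exists (x ^ g), (y ^ g).
by split; [apply/set_conjJ | apply/set_conjJ | apply/le_conj].
Qed.

Lemma chain_qle_conj g H X Y : qle c H X Y ->
  qle c (set_conj g H) (set_conj g X) (set_conj g Y).
Proof.
have qJ Z : canonical_quotient le H Z ->
    canonical_quotient le (set_conj g H) (set_conj g Z).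
  by move/(quotient_conj g); rewrite canonical_low_conj.
case=> VH qX qY XY; split; [exact: canonical_conj | exact: qJ | exact: qJ |].
exact: quotient_le_conj.
Qed.

Lemma chain_admissible : admissible c.
Proof.
rewrite /admissible /least_level /level_quotient chain_levels; split.
- by move=> g g1; exists (span le 1 g); apply: canonical_least.
- by move=> H VH; split; [apply: canonical_normal | apply: canonical_proper].
- split=> H [VH tot]; last first.
    move=> X Y qX qY; rewrite -(tot _ _ qX qY); split=> [[]//|l].
    by split.
  split; last first.
    move=> A B X Y qA qB qX qY [_ _ _ [x [y [Xx Yy xy]]]].
    have qM Z W : canonical_quotient le H Z -> canonical_quotient le H W ->
        canonical_quotient le H (set_mul Z W).
      move=> [z Hz <-] [w Hw <-]; exists (z * w).
        by case: (canonical_subgroup VH) => _ HM _; apply: HM.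
      rewrite (set_mul_lcoset _ (canonical_subgroup VH)) //.
      exact: canonical_normal.
    split=> //; try by do 2!apply: (qM) => //.
    (* Cosets are nonempty, so invariance of [le] can be applied to representatives. *)
    have qI Z : canonical_quotient le H Z -> exists z, Z z.
      move=> [z _ <-]; exists z; apply: lcoset_of_refl.
      exact: canonical_lower_subgroup.
    have [a Aa] := qI A qA; have [b Bb] := qI B qB.
    exists (a * x * b), (a * y * b); split; last by case: leG => _; apply.
      by exists (a * x); [exists a => //; exists x | exists b].
    by exists (a * y); [exists a => //; exists y | exists b].
  case: tot => [[r s t] tot]; split; last first.
    move=> X Y qX qY; case: (tot _ _ qX qY); [left|right]; by split.
  split.
  + by move=> X qX; split=> //; apply: r.
  + by move=> X Y qX qY [_ _ _ XY] [_ _ _ YX]; apply: s.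
  + move=> X Y Z qX qY qZ [_ _ _ XY] [_ _ _ YZ]; split=> //.
    exact: (t _ Y).
- move=> g.
  (* Types are read off from the relation to 1 of the elements outside the lower part, and
     conjugation preserves that relation. *)
  have outJ H (rel : G -> G -> Prop) :
      (forall x y, rel (x ^ g) (y ^ g) <-> rel x y) ->
      (forall x, H x -> ~ low H x -> rel 1 x) ->
      forall x, set_conj g H x -> ~ low (set_conj g H) x -> rel 1 x.
    move=> relJ h x; rewrite -canonical_low_conj !set_conjE => Hx nx.
    by rewrite -(conjgKV g x) -(conj1g g) relJ; apply: h.
  split=> [H /chain_typeC[VH h]|H /chain_typeA[VH h]|H X Y _ _ _].
  + apply/chain_typeC; split; first exact: canonical_conj.
    apply: outJ h => x y; rewrite /comparable /strict !le_conj.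
    have e u v : u ^ g = v ^ g <-> u = v.
      by split=> [/conjg_inj|->].
    by rewrite !e.
  + apply/chain_typeA; split; first exact: canonical_conj.
    by apply: outJ h => x y; rewrite /incomparable !le_conj.
  split; first exact: chain_qle_conj.
  by move/(chain_qle_conj g^-1); rewrite !set_conjK.
Qed.

Lemma chain_reduced : reduced c.
Proof.
split=> K H.
  move=> /chain_typeC[VK hK] /chain_typeC[VH hH] KH.
  have [L [VL KL LH hL]] := canonical_reduced_comparable VK VH KH hK hH.
  by exists L; split=> //; apply/chain_typeA.
move=> /chain_typeA[VK hK] /chain_typeA[VH hH] KH.
have [L [VL KL LH hL]] := canonical_reduced_incomparable VK VH KH hK hH.
by exists L; split=> //; apply/chain_typeC.
Qed.

End OrderedGroup.

Lemma chain_data_eq (G : groupType) (c c' : chain_data G) :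
  (forall H, typeC c H <-> typeC c' H) ->
  (forall H, typeA c H <-> typeA c' H) ->
  (forall H X Y, qle c H X Y <-> qle c' H X Y) -> c = c'.
Proof.
case: c c' => [C A q] [C' A' q'] /= CE AE QE; congr ChainData.
- by apply/seteqP; split=> H /CE.
- by apply/seteqP; split=> H /AE.
- by apply: funext => H; apply: funext => X; apply: funext => Y; apply: propext.
Qed.

(** * The order defined by an admissible chain *)

Section OrderOfChain.
Variables (G : groupType) (c : chain_data G).
Hypotheses (c2 : is_two_coloured_chain c) (cadm : admissible c).
Implicit Types (H K L : set G).

Let low := lower (levels c).

Let level_subgroup H : levels c H -> is_subgroup H.
Proof. by case: c2 => h _ _ _; apply: h. Qed.

Let levels_total : total_on (levels c) subset.
Proof. by case: c2. Qed.

Let level_exists g : g <> 1 -> exists H, least_level c g H.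
Proof. by case: cadm => h _ _ _; apply: h. Qed.

Let low_normal H : levels c H -> is_normal_in (low H) H.
Proof. by case: cadm => _ h _ _ /h[]. Qed.

Let low_subgroup H : is_subgroup (low H).
Proof. exact: lower_subgroup level_subgroup levels_total H. Qed.

Let least_levelP g H : g <> 1 -> least_level c g H ->
  [/\ levels c H, H g & ~ low H g].
Proof.
move=> g1 lH; have := least_not_lower g1 lH.
by case: lH => -[FH Hg] _; split.
Qed.

Let level_least H g : levels c H -> H g -> ~ low H g -> least_level c g H.
Proof. exact: level_least levels_total H g. Qed.

Let level_unique g H K : least_level c g H -> least_level c g K -> H = K.
Proof. exact: least_unique. Qed.

Let not_low_neq1 H g : ~ low H g -> g <> 1.
Proof. by move=> ng g1; apply: ng; rewrite g1; left. Qed.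

Let qle_mul2l H a x y : typeC c H -> H a -> H x -> H y ->
  qle c H (lcoset_of x (low H)) (lcoset_of y (low H)) ->
  qle c H (lcoset_of (a * x) (low H)) (lcoset_of (a * y) (low H)).
Proof.
move=> CH Ha Hx Hy l; have FH : levels c H by left.
have [H1 HM _] := level_subgroup FH.
have [_ h] : is_total_group_order (level_quotient c H) (qle c H).
  by case: cadm => _ _ [h _] _; apply: h.
have q z : H z -> level_quotient c H (lcoset_of z (low H)) by exists z.
have sM := set_mul_lcoset _ (level_subgroup FH) (low_normal FH).
have := h _ _ _ _ (q a Ha) (q 1 H1) (q x Hx) (q y Hy) l.
by rewrite !sM ?mulg1 //; apply: HM.
Qed.

(** The strictly positive cone. As [g] is outside H^-, its coset differs from H^-, so [qle] is
    automatically strict here. *)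
Definition chain_pos g := g <> 1 /\ exists H, [/\ least_level c g H, typeC c H &
  qle c H (lower (levels c) H) (lcoset_of g (lower (levels c) H))].

Definition order_of_chain x y := x = y \/ chain_pos (x^-1 * y).

Let le := order_of_chain.

Lemma chain_posE g H : g <> 1 -> least_level c g H ->
  chain_pos g <-> typeC c H /\ qle c H (low H) (lcoset_of g (low H)).
Proof.
move=> g1 lH; split=> [[_ [K [lK CK qK]]]|[CH qH]].
  by rewrite (level_unique lH lK).
by split=> //; exists H.
Qed.

Let least_level_inv g H : g <> 1 -> least_level c g H ->
  least_level c g^-1 H.
Proof.
move=> g1 /(least_levelP g1)[FH Hg ng]; apply: level_least => //.
  by case: (level_subgroup FH) => _ _; apply.
by move/(subgroupV (low_subgroup _)).
Qed.

Lemma chain_pos_asym g : chain_pos g -> ~ chain_pos g^-1.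
Proof.
move=> [g1 [H [lH CH q]]]; have g1' : g^-1 <> 1.
  by move=> /(congr1 (@inv G)); rewrite invgK invg1.
move/(chain_posE g1' (least_level_inv g1 lH)) => [_ q'].
have [FH Hg ng] := least_levelP g1 lH; have [H1 _ HV] := level_subgroup FH.
have q1 : qle c H (lcoset_of 1 (low H)) (lcoset_of g^-1 (low H)).
  by rewrite lcoset_of1.
have := qle_mul2l CH Hg H1 (HV _ Hg) q1.
rewrite mulg1 mulgV lcoset_of1 => {}q1.
case: cadm => _ _ [/(_ H CH)[[[_ anti _] _] _] _] _.
apply: ng; apply/(lcoset_of_memP _ (low_subgroup H)); apply: anti => //.
  by exists g.
by exists 1 => //; rewrite lcoset_of1.
Qed.

(** The factor of smaller level lies in H^-, so the product stays in [H] and outside H^-; this is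
    the ultrametric inequality for levels. *)
Let least_level_mull g h H K : g <> 1 -> h <> 1 -> least_level c g H ->
  least_level c h K -> K `<` H -> least_level c (g * h) H.
Proof.
move=> g1 h1 /(least_levelP g1)[FH Hg ng] /(least_levelP h1)[FK Kh _] KH.
have lh : low H h by exact: subset_lower KH _ Kh.
apply: level_least => //.
  case: (level_subgroup FH) => _ HM _; apply: HM => //.
  by case: KH => KH _; apply: KH.
by move/(subgroupMr _ (low_subgroup H) lh).
Qed.

Let least_level_mulr g h H K : g <> 1 -> h <> 1 -> least_level c g H ->
  least_level c h K -> K `<` H -> least_level c (h * g) H.
Proof.
move=> g1 h1 /(least_levelP g1)[FH Hg ng] /(least_levelP h1)[FK Kh _] KH.
have lh : low H h by exact: subset_lower KH _ Kh.
apply: level_least => //.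
  case: (level_subgroup FH) => _ HM _; apply: HM => //.
  by case: KH => KH _; apply: KH.
by move/(subgroupMl _ (low_subgroup H) lh).
Qed.

(** By normality of H^-, both products lie in the coset of [g], and positivity depends only on that
    coset. *)
Let pos_mul_low H g n : levels c H -> H g -> ~ low H g -> low H n ->
  (chain_pos (g * n) <-> chain_pos g) /\ (chain_pos (n * g) <-> chain_pos g).
Proof.
move=> FH Hg ng ln; have sl := low_subgroup H.
have Hn := lower_sub level_subgroup FH ln.
have [_ HM _] := level_subgroup FH.
have ngn : ~ low H (g * n) by move/(subgroupMr _ sl ln).
have nng : ~ low H (n * g) by move/(subgroupMl _ sl ln).
have e1 : lcoset_of (g * n) (low H) = lcoset_of g (low H).
  by apply/esym/(lcoset_of_eq _ _ sl); rewrite mulKg.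
have e2 : lcoset_of (n * g) (low H) = lcoset_of g (low H).
  apply/esym/(lcoset_of_eq _ _ sl).
  by case: (low_normal FH) => _ _ /(_ g n Hg ln); rewrite conjgE.
rewrite (chain_posE (not_low_neq1 ng) (level_least FH Hg ng)).
rewrite (chain_posE (not_low_neq1 ngn) (level_least FH (HM _ _ Hg Hn) ngn)).
rewrite (chain_posE (not_low_neq1 nng) (level_least FH (HM _ _ Hn Hg) nng)).
by rewrite e1 e2.
Qed.

(** With different levels the factor of smaller level is absorbed. With equal levels transitivity in
    the quotient applies, once the product is known to lie outside H^-. *)
Lemma chain_pos_mul g h : chain_pos g -> chain_pos h -> chain_pos (g * h).
Proof.
move=> pg ph; have [g1 [H [lH CH qg]]] := pg; have [h1 [K [lK CK qh]]] := ph.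
have [FH Hg ng] := least_levelP g1 lH; have [FK Kh nh] := least_levelP h1 lK.
have [HK|KH] := level_total levels_total FH FK; last first.
  by have [-> _] := pos_mul_low FH Hg ng (subset_lower FK KH Kh).
have [KH|HK'] := level_total levels_total FK FH; last first.
  by have [_ ->] := pos_mul_low FK Kh nh (subset_lower FH HK' Hg).
have {HK KH} e : H = K by apply/seteqP.
subst K; have [H1 HM HV] := level_subgroup FH.
have ngh : ~ low H (g * h).
  (* If [g * h] were in H^-, then [h^-1] would differ from the positive [g] by a factor in H^-, and
     would be positive along with [h]. *)
  move=> lgh; apply: (chain_pos_asym ph).
  have e : h^-1 = (g * h)^-1 * g by rewrite invgM mulgVK.
  have [_ _ lowV] := low_subgroup H.
  have := pos_mul_low FH Hg ng (lowV _ lgh).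
  by rewrite -e => -[_ ->].
apply/(chain_posE (not_low_neq1 ngh) (level_least FH (HM _ _ Hg Kh) ngh)).
split=> //.
have qh1 : qle c H (lcoset_of 1 (low H)) (lcoset_of h (low H)).
  by rewrite lcoset_of1.
have := qle_mul2l CH Hg H1 Kh qh1; rewrite mulg1 => qgh.
case: cadm => _ _ [/(_ H CH)[[[_ _ tr] _] _] _] _.
apply: tr qg qgh.
- by exists 1 => //; rewrite lcoset_of1.
- by exists g.
- by exists (g * h) => //; apply: HM.
Qed.

Let level_conj a H : levels c H -> levels c (set_conj a H).
Proof.
case: cadm => _ _ _ /(_ a)[hC hA _] [/hC|/hA]; by [left|right].
Qed.

Lemma chain_pos_conj a g : chain_pos g -> chain_pos (g ^ a).
Proof.
move=> [g1 [H [lH CH q]]]; have [FH Hg ng] := least_levelP g1 lH.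
have lowJ : set_conj a (low H) = low (set_conj a H).
  by apply: lower_conj => *; apply: level_conj.
have nga : ~ low (set_conj a H) (g ^ a) by rewrite -lowJ set_conjJ.
have Hga : set_conj a H (g ^ a) by rewrite set_conjJ.
apply/(chain_posE (not_low_neq1 nga) (level_least (level_conj a FH) Hga nga)).
case: cadm => _ _ _ /(_ a)[hC _ hq]; split; first exact: hC.
move: q; rewrite hq // ?lowJ ?set_conj_lcoset ?lowJ //.
  by exists 1; [case: (level_subgroup FH) | rewrite lcoset_of1].
by exists g.
Qed.

Lemma order_of_chain_strict x y : strict le x y <-> chain_pos (x^-1 * y).
Proof.
split=> [[[//|//]]|p]; split; first by right.
by move=> xy; case: p; rewrite xy mulVg.
Qed.

Lemma order_of_chain_group_order : is_group_order le.
Proof.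
split; first split=> [x _|x y _ _ [//|p] [//|q]|x y z _ _ _].
- by left.
- by case: (chain_pos_asym p); rewrite invgM invgK.
- move=> [->//|p] [<-|q]; first by right.
  by right; have := chain_pos_mul p q; rewrite mulgA mulgK.
move=> a b x y [->|p]; first by left.
right; have -> : (a * x * b)^-1 * (a * y * b) = (x^-1 * y) ^ b.
  by rewrite conjgE !group_norm.
exact: chain_pos_conj.
Qed.

Let leG := order_of_chain_group_order.

Lemma typeCA H : typeC c H -> ~ typeA c H.
Proof.
by case: c2 => _ _ d _ CH AH; have : (typeC c `&` typeA c) H by []; rewrite d.
Qed.

(** In a level of type C, totality of the quotient makes [x^-1 * y] or its inverse positive; both
    have the same level. *)
Lemma comparable_typeC x y H : least_level c (x^-1 * y) H -> x <> y ->
  comparable le x y <-> typeC c H.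
Proof.
move=> lH xy; have xy1 : x^-1 * y <> 1.
  by move=> e; apply: xy; rewrite -(mulVKg x y) e mulg1.
rewrite /comparable !order_of_chain_strict.
have -> : y^-1 * x = (x^-1 * y)^-1 by rewrite invgM invgK.
move: (x^-1 * y) lH xy1 => g lH g1.
have g1' : g^-1 <> 1 by move=> /(congr1 (@inv G)); rewrite invgK invg1.
rewrite (chain_posE g1 lH) (chain_posE g1' (least_level_inv g1 lH)).
split=> [[[]|[]]//|CH].
have [FH Hg ng] := least_levelP g1 lH; have [H1 _ HV] := level_subgroup FH.
have [[_ tot] _] : is_total_group_order (level_quotient c H) (qle c H).
  by case: cadm => _ _ [h _] _; apply: h.
have [||q|q] := tot (lcoset_of 1 (low H)) (lcoset_of g (low H)).
- by exists 1.
- by exists g.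
- by left; split=> //; rewrite -{1}(lcoset_of1 (low H)).
right; split=> //; have := qle_mul2l CH (HV _ Hg) Hg H1 q.
by rewrite mulVg mulg1 lcoset_of1.
Qed.

Let incomparable_typeA x y H : least_level c (x^-1 * y) H -> x <> y ->
  ~ comparable le x y -> typeA c H.
Proof.
move=> lH xy nc; have [[FH _] _] := lH; case: FH => // CH.
by case: nc; apply/(comparable_typeC lH).
Qed.

(* In a triangle, the two largest levels coincide. *)
Let triangle g h H K L : g <> 1 -> h <> 1 ->
  least_level c g H -> least_level c h K -> least_level c (g * h) L ->
  L <> H -> L <> K -> H = K /\ L `<` H.
Proof.
move=> g1 h1 lH lK lL LH LK.
have [[FH Hg] _] := lH; have [[FK Kh] _] := lK.
have [HK|KH] := level_total levels_total FH FK; last first.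
  by case: LH; apply: level_unique lL (least_level_mull g1 h1 lH lK KH).
have [KH|HK'] := level_total levels_total FK FH; last first.
  by case: LK; apply: level_unique lL (least_level_mulr h1 g1 lK lH HK').
have e : H = K by apply/seteqP.
subst K; split=> //; have LsubH : L `<=` H.
  case: lL => _; apply; split=> //.
  by case: (level_subgroup FH) => _ HM _; apply: HM.
by split=> // HL; apply: LH; apply/seteqP.
Qed.

(* In an N, the levels of the pairs xy, yz, zt have type C and those of xz, yt,
   xt have type A; the three triangles force contradictory inclusions. *)
Lemma order_of_chain_N_free : N_free le.
Proof.
move=> x y z t.
rewrite /= !inE !negb_or -!andbA => /and4P[xy xz xt /and4P[yz yt zt _]] h.
have lev (u v : G) : u != v -> exists H, least_level c (u^-1 * v) H.
  move/eqP => uv; apply: level_exists => e.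
  by apply: uv; rewrite -(mulVKg u v) e mulg1.
have n1 (u v : G) : u != v -> u^-1 * v <> 1.
  by move/eqP => uv e; apply: uv; rewrite -(mulVKg u v) e mulg1.
have nF (u v : G) : u != v -> ((u == v) = false) * ((v == u) = false).
  by move=> uv; split; [|rewrite eq_sym]; apply: negbTE.
have memx : x \in [:: x; y; z; t] by rewrite !inE eqxx.
have memy : y \in [:: x; y; z; t] by rewrite !inE eqxx !orbT.
have memz : z \in [:: x; y; z; t] by rewrite !inE eqxx !orbT.
have memt : t \in [:: x; y; z; t] by rewrite !inE eqxx !orbT.
have cxy : comparable le x y.
  by left; apply/h; rewrite // !inE eqxx.
have cyz : comparable le y z.
  by right; apply/h; rewrite // !inE eqxx !orbT.
have czt : comparable le z t.
  by left; apply/h; rewrite // !inE eqxx !orbT.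
have nc u v : u \in [:: x; y; z; t] -> v \in [:: x; y; z; t] ->
    (u, v) \notin [:: (x, y); (z, y); (z, t)] ->
    (v, u) \notin [:: (x, y); (z, y); (z, t)] -> ~ comparable le u v.
  by move=> mu mv /negP nuv /negP nvu [l|l]; [apply: nuv|apply: nvu]; apply/h.
have [cxz cyt cxt] : [/\ ~ comparable le x z, ~ comparable le y t &
    ~ comparable le x t].
  by split; apply: nc => //; rewrite !inE !xpair_eqE !(nF _ _ xy, nF _ _ xz,
    nF _ _ xt, nF _ _ yz, nF _ _ yt, nF _ _ zt) ?andbF.
have [P lP] := lev _ _ xy; have [Q lQ] := lev _ _ yz.
have [R lR] := lev _ _ zt; have [S lS] := lev _ _ xz.
have [U lU] := lev _ _ yt; have [W lW] := lev _ _ xt.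
have CP := iffLR (comparable_typeC lP (elimN eqP xy)) cxy.
have CQ := iffLR (comparable_typeC lQ (elimN eqP yz)) cyz.
have CR := iffLR (comparable_typeC lR (elimN eqP zt)) czt.
have AS := incomparable_typeA lS (elimN eqP xz) cxz.
have AU := incomparable_typeA lU (elimN eqP yt) cyt.
have AW := incomparable_typeA lW (elimN eqP xt) cxt.
have CA H K : typeC c H -> typeA c K -> H <> K.
  by move=> CH AK HK; apply: (typeCA CH); rewrite HK.
have AC H K : typeA c H -> typeC c K -> H <> K.
  by move=> AH CK /esym; apply: CA.
have lS' : least_level c (x^-1 * y * (y^-1 * z)) S by rewrite mulgA mulgK.
have lU' : least_level c (y^-1 * z * (z^-1 * t)) U by rewrite mulgA mulgK.
have [ePQ _] := triangle (n1 _ _ xy) (n1 _ _ yz) lP lQ lS'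
  (AC _ _ AS CP) (AC _ _ AS CQ).
have [_ UQ] := triangle (n1 _ _ yz) (n1 _ _ zt) lQ lR lU'
  (AC _ _ AU CQ) (AC _ _ AU CR).
have ty1 : t^-1 * y <> 1 by apply: n1; rewrite eq_sym.
have lty : least_level c (t^-1 * y) U.
  by have := least_level_inv (n1 _ _ yt) lU; rewrite invgM invgK.
have lP' : least_level c (x^-1 * t * (t^-1 * y)) P by rewrite mulgA mulgK.
have [eWU PW] := triangle (n1 _ _ xt) ty1 lW lty lP'
  (CA _ _ CP AW) (CA _ _ CP AU).
by case: UQ => _; apply; rewrite -ePQ -eWU; case: PW.
Qed.

(** The level L of an outside element [w] strictly contains [H], so [H] lies in L^-, and multiplying
    [w] or its inverse by an element of [H] does not affect positivity. *)
Let level_module H : levels c H -> is_module le H.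
Proof.
move=> FH; have sH := level_subgroup FH; have [H1 HM HV] := sH.
apply: (@module_from_base _ _ _ 1) => w m nHw Hm.
have w1 : w <> 1 by move=> w1; apply: nHw; rewrite w1.
have [L lL] := level_exists w1; have [FL Lw nw] := least_levelP w1 lL.
have lm n : H n -> low L n.
  move=> Hn; have [LH|HL] := level_total levels_total FL FH.
    by case: nHw; apply: LH.
  exact: subset_lower HL _ Hn.
have nwV : ~ low L w^-1 by move/(subgroupV (low_subgroup L)).
have LwV : L w^-1 by case: (level_subgroup FL) => _ _; apply.
have wm : w <> m by move=> wm; apply: nHw; rewrite wm.
have [r _] := pos_mul_low FL LwV nwV (lm _ Hm).
have [_ l] := pos_mul_low FL Lw nw (lm _ (HV _ Hm)).
have e u v : u <> v -> le u v <-> chain_pos (u^-1 * v).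
  by move=> uv; split=> [[]//|]; right.
rewrite !e ?mulg1 ?invg1 ?mul1g //; by [apply: nesym|tauto].
Qed.

(** * Levels of a reduced chain are the canonical levels of its order *)

Hypothesis cred : reduced c.

Let level_opposite K L : levels c K -> levels c L -> K `<` L ->
  (typeC c K <-> typeC c L) ->
  exists J, [/\ levels c J, K `<` J, J `<` L & ~ (typeC c J <-> typeC c K)].
Proof.
case: cred => rC rA FK FL KL e; case: (FK) => [CK|AK].
  have [J [AJ KJ JL]] := rC K L CK (iffLR e CK) KL.
  exists J; split=> //; first by right.
  by move=> [_ /(_ CK) /typeCA].
have AL : typeA c L.
  by case: FL => // /(iffRL e) /typeCA; case.
have [J [CJ KJ JL]] := rA K L AK AL KL.
exists J; split=> //; first by left.
by move=> [/(_ CJ) /typeCA].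
Qed.

(* If a module M contains a in H and w outside H, but misses h in H, then the
   levels K of ha and L of aw have the same type.  By reducedness some J of the
   opposite type lies between them, and a * j, for j of level J, can lie neither
   in M nor outside M. *)
Lemma level_strong H : levels c H -> is_strong_module le H.
Proof.
move=> FH; have sH := level_subgroup FH; have [H1 HM HV] := sH.
split; [exact: level_module | by exists 1 |] => M mM.
have [[a [Ma Ha]]|dM] := EM (M `&` H !=set0); last first.
  by apply: Or31; rewrite -subset0 => a Ma; apply: dM; exists a.
have [MH|/existsNP[w /not_implyP[Mw nHw]]] := EM (M `<=` H); first exact: Or32.
apply: Or33 => h Hh; apply: contrapT => nMh.
have ha : h <> a by move=> ha; apply: nMh; rewrite ha.
have ne1 (u v : G) : u <> v -> u^-1 * v <> 1.
  by move=> uv e; apply: uv; rewrite -(mulVKg u v) e mulg1.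
have mulE (u v p : G) : u^-1 * v * (v^-1 * p) = u^-1 * p by rewrite mulgA mulgK.
have aw : a <> w by move=> aw; apply: nHw; rewrite -aw.
have hw : h <> w by move=> hw; apply: nHw; rewrite -hw.
have [K lK] := level_exists (ne1 _ _ ha).
have [L lL] := level_exists (ne1 _ _ aw).
have [[FK _] leK] := lK; have [[FL Law] _] := lL.
have KH : K `<=` H by apply: leK; split=> //; apply: HM => //; apply: HV.
have HL : H `<` L.
  have [LH|//] := level_total levels_total FL FH.
  by case: nHw; rewrite -(mulVKg a w); apply: HM => //; apply: LH.
have KL : K `<` L.
  case: HL => HL LH; split=> [|LK]; first exact: subset_trans HL.
  by apply: LH; apply: subset_trans KH.
have lhw : least_level c (h^-1 * w) L.
  by rewrite -(mulE h a w); apply: least_level_mulr KL => //; apply: ne1.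
have cKL : typeC c K <-> typeC c L.
  rewrite -(comparable_typeC lK ha) -(comparable_typeC lhw hw).
  by split; apply: (module_comparable mM nMh).
have [J [FJ KJ JL tJ]] := level_opposite FK FL KL cKL.
have [j [Jj nj]] : exists j, J j /\ ~ low J j.
  case: cadm => _ /(_ J FJ)[_ [_ nJ]] _ _; apply: contrapT => nj.
  by apply: nJ => j Jj; apply: contrapT => lj; apply: nj; exists j.
have j1 := not_low_neq1 nj; have lJ := level_least FJ Jj nj.
have lap : least_level c (a^-1 * (a * j)) J by rewrite mulKg.
have ap : a <> a * j by move=> e; apply: j1; rewrite -(mulKg a j) -e mulVg.
have lpw : least_level c ((a * j)^-1 * w) L.
  rewrite -(mulE (a * j) a w) invgM mulgVK; apply: least_level_mulr JL => //.
  - exact: ne1.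
  - by move=> /(congr1 (@inv G)); rewrite invgK invg1.
  - exact: least_level_inv.
have lhp : least_level c (h^-1 * (a * j)) J.
  by rewrite mulgA; apply: least_level_mulr KJ => //; apply: ne1.
have Mp : M (a * j).
  apply: contrapT => nMp; apply: tJ; rewrite cKL.
  have pw : a * j <> w by move=> pw; apply: nMp; rewrite pw.
  rewrite -(comparable_typeC lap ap) -(comparable_typeC lpw pw).
  split=> [/comparableC|] cp; last apply: comparableC;
    by apply: (module_comparable mM nMp) cp.
apply: tJ; have hp : h <> a * j by move=> hp; apply: nMh; rewrite hp.
rewrite -(comparable_typeC lhp hp) -(comparable_typeC lK ha).
by split; apply: (module_comparable mM nMh).
Qed.

(** Strength of [H] gives one inclusion. Conversely the span is a strong subgroup containing [g],
    which is outside H^-, and modulo H^- the level is a chain or an antichain, so a collapse lemma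
    gives [H] inside the span. *)
Lemma span_level g H : g <> 1 -> least_level c g H -> span le 1 g = H.
Proof.
move=> g1 lH; have [FH Hg ng] := least_levelP g1 lH.
have sH := level_subgroup FH; have strH := level_strong FH.
have SH : span le 1 g `<=` H by apply: span_sub => //; case: sH.
apply/seteqP; split=> //.
have lowM : is_module le (low H).
  apply: lower_module => K FK; split; first exact: level_subgroup.
  exact: level_module.
have lev x : H x -> ~ low H x -> 1 <> x /\ least_level c (1^-1 * x) H.
  move=> Hx nx; split; first exact/nesym/not_low_neq1/nx.
  by rewrite invg1 mul1g; apply: level_least.
case: (FH) => [CH|AH].
  apply: (@collapse_comparable _ _ leG (low H) _ _ g) => //.
  - exact: span1_subgroup.
  - exact: span_strong.
  - exact: level_module.
  move=> x Hx nx; have [x1 lx] := lev x Hx nx.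
  exact/(comparable_typeC lx x1).
apply: (@collapse_incomparable _ _ leG (low H) _ _ g) => //.
- exact: span1_subgroup.
- exact: span_strong.
- exact: level_module.
- exact: lower_sub.
move=> x Hx nx; have [x1 lx] := lev x Hx nx.
apply: not_comparable => // /(comparable_typeC lx x1) /typeCA; exact.
Qed.

Lemma canonical_levels_chain : canonical_levels le = levels c.
Proof.
apply/seteqP; split=> H.
  move=> /canonical_levelP[g g1 ->]; have [K lK] := level_exists g1.
  by rewrite (span_level g1 lK); case: lK => -[].
move=> FH; case: cadm => _ /(_ H FH)[_ [_ nH]] _ _.
have [g [Hg ng]] : exists g, H g /\ ~ low H g.
  apply: contrapT => h; apply: nH => g Hg; apply: contrapT => ng.
  by apply: h; exists g.
apply/canonical_levelP; exists g; first exact: not_low_neq1 ng.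
rewrite (@span_level g H) //; first exact: not_low_neq1 ng.
exact: level_least.
Qed.

(** For distinct cosets of [x] and [y], left multiplication by [x] or its inverse passes between the
    pair of cosets and the comparison of H^- with the coset of [x^-1 * y], which defines
    positivity. *)
Let quotient_qle H X Y : levels c H -> level_quotient c H X ->
  level_quotient c H Y -> quotient_le le X Y <-> qle c H X Y.
Proof.
move=> FH [x Hx <-] [y Hy <-]; have [H1 HM HV] := level_subgroup FH.
have lowM : is_module le (low H).
  apply: lower_module => K FK; split; first exact: level_subgroup.
  exact: level_module.
rewrite (quotient_leE leG (low_subgroup H) lowM).
have q z : H z -> level_quotient c H (lcoset_of z (low H)) by exists z.
have [/[dup] lxy /(lcoset_of_eq _ _ (low_subgroup H)) ->|nxy] :=
    EM (low H (x^-1 * y)).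
  split=> _; last by left.
  case: cadm => _ _ [tC tA] _; case: FH => [CH|AH].
    by have [[[r _ _] _] _] := tC H CH; apply: r; apply: q.
  by apply/(tA H AH); try exact: q.
have xy1 := not_low_neq1 nxy.
have xy : x <> y by move=> xy; apply: xy1; rewrite xy mulVg.
have lH := level_least FH (HM _ _ (HV _ Hx) Hy) nxy.
have -> : low H (x^-1 * y) \/ le x y <-> chain_pos (x^-1 * y).
  by split=> [[//|[]//]|p]; right; right.
rewrite (chain_posE xy1 lH); case: (FH) => [CH|AH].
  split=> [[_ q1]|q']; last split=> //.
    have := @qle_mul2l _ x 1 (x^-1 * y) CH Hx H1.
    rewrite lcoset_of1 mulg1 mulVKg; apply=> //.
    by apply: HM => //; apply: HV.
  by have := qle_mul2l CH (HV _ Hx) Hx Hy q'; rewrite mulVg lcoset_of1.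
split=> [[/typeCA//]|]; case: cadm => _ _ [_ /(_ H AH) h] _.
rewrite h; try exact: q.
by move/(lcoset_of_eq _ _ (low_subgroup H)).
Qed.

Lemma chain_of_orderK : chain_of_order le = c.
Proof.
have V : canonical_levels le = levels c := canonical_levels_chain.
have CE H : typeC (chain_of_order le) H <-> typeC c H.
  rewrite chain_typeC // V -/low; split=> [[FH h]|CH].
    have FH' := FH; rewrite -V in FH'.
    have [g [Hg ng]] := canonical_witness leG FH'; rewrite V in ng.
    have lH : least_level c (1^-1 * g) H.
      by rewrite invg1 mul1g; apply: level_least.
    apply/(comparable_typeC lH); last exact: h.
    exact/nesym/not_low_neq1/ng.
  split=> [|x Hx nx]; first by left.
  have lH : least_level c (1^-1 * x) H.
    by rewrite invg1 mul1g; apply: level_least => //; left.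
  by apply/(comparable_typeC lH) => //; apply/nesym/not_low_neq1/nx.
(* In both chains the two types partition the same set of levels, so agreement on type C forces
   agreement on type A. *)
have AE H : typeA (chain_of_order le) H <-> typeA c H.
  have lN := order_of_chain_N_free.
  have L : levels (chain_of_order le) = levels c by rewrite chain_levels.
  have d H' : ~ (typeC (chain_of_order le) H' /\ typeA (chain_of_order le) H').
    have [_ _ d _] := chain_two_coloured leG lN.
    move=> h; suff : (typeC (chain_of_order le) `&`
        typeA (chain_of_order le)) H' by rewrite d.
    exact: h.
  split=> AH.
    have : levels c H by rewrite -L; right.
    by case=> // /CE CH; case: (d H); split.
  have : levels (chain_of_order le) H by rewrite L; right.
  by case=> // /CE CH; case: (typeCA CH).
(* Both relations are false outside the quotients of levels, so comparing them on cosets suffices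
   for equality of the chain data. *)
have QE H X Y : qle (chain_of_order le) H X Y <-> qle c H X Y.
  rewrite /= /canonical_quotient V; split=> [[FH qX qY l]|q].
    exact/(quotient_qle FH qX qY).
  have [_ _ _ /(_ H X Y q)[FH qX qY]] := c2; split=> //.
  exact/(quotient_qle FH qX qY).
exact: chain_data_eq CE AE QE.
Qed.

End OrderOfChain.

(** Invariance reduces the claim to positivity of one [g], whose level is S(1, g). As [g] is outside
    the lower part, the quotient order compares its coset with the identity coset exactly as [le]
    compares [g] with 1. *)
Lemma order_of_chainK (G : groupType) (le : G -> G -> Prop) :
  is_group_order le -> N_free le -> order_of_chain (chain_of_order le) = le.
Proof.
move=> leG leN; have le_po := leG.1.
have L := chain_levels leG leN.
apply: funext => x; apply: funext => y; apply: propext.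
have [->|xy] := EM (x = y); first by split=> _; [exact: po_refl | left].
have g1 : x^-1 * y <> 1 by move=> e; apply: xy; rewrite -(mulVKg x y) e mulg1.
have -> : order_of_chain (chain_of_order le) x y <->
    chain_pos (chain_of_order le) (x^-1 * y).
  by split=> [[]//|]; right.
rewrite -(le_1div leG); move: (x^-1 * y) g1 => g g1 {x y xy}.
have lS := canonical_least leG g1; have VS := canonical_span le g1.
have ng := least_not_lower g1 lS.
have lS' : least_level (chain_of_order le) g (span le 1 g).
  by rewrite /least_level L.
rewrite (chain_posE g1 lS') L chain_typeC //.
have sl := canonical_lower_subgroup leG (span le 1 g).
have ml := @canonical_lower_module _ _ leG (span le 1 g).
have [S1 _ _] := canonical_subgroup leG VS.
have qE : quotient_le le (lower (canonical_levels le) (span le 1 g))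
    (lcoset_of g (lower (canonical_levels le) (span le 1 g))) <-> le 1 g.
  have := quotient_leE leG sl ml 1 g.
  by rewrite lcoset_of1 invg1 mul1g => ->; split; [case|right].
split=> [[_ [_ _ _ /qE]]//|lg]; split; last first.
  split=> //; last exact/qE.
    by exists 1; rewrite ?lcoset_of1.
  by exists g.
(* A positive [g] outside the lower part rules out an antichain level. *)
split=> //; have [//|i] := canonical_dichotomy leG leN VS.
by case: (i g _ ng).
Qed.

Theorem theorem1p3 (G : groupType) :
  exists (order_of : reduced_admissible_chain G -> N_free_group_order G)
         (chain_of : N_free_group_order G -> reduced_admissible_chain G),
  [/\ cancel order_of chain_of,
      cancel chain_of order_of,
      forall C : reduced_admissible_chain G,
        let c := sval C in
        let le := sval (order_of C) in
        (forall (g : G) (H : set G), g <> 1 -> least_level c g H ->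
           let N := lower (levels c) H in
           (strict le 1 g <->
              typeC c H /\ strict (qle c H) N (lcoset_of g N)) /\
           (typeA c H -> incomparable le g 1)) /\
        (forall x y : G, strict le x y <-> strict le 1 (x^-1 * y)) &
      forall P : N_free_group_order G,
        let le := sval P in
        let c := sval (chain_of P) in
        [/\ levels c = canonical_levels le,
            forall H : set G, typeC c H <->
              canonical_levels le H /\
              total_order_on (canonical_quotient le H) (quotient_le le),
            forall H : set G, typeA c H <->
              canonical_levels le H /\
              equality_order_on (canonical_quotient le H) (quotient_le le),
            forall H X Y : set G, canonical_levels le H ->
              canonical_quotient le H X -> canonical_quotient le H Y ->
              (qle c H X Y <-> quotient_le le X Y) &
            forall (g : G) (H : set G), g <> 1 ->
              (least_level c g H <-> is_S le 1 g H)]].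
Proof.
have orderP (c : chain_data G) :
    [/\ is_two_coloured_chain c, admissible c & reduced c] ->
    is_group_order (order_of_chain c) /\ N_free (order_of_chain c).
  move=> [c2 cadm _]; split; first exact: order_of_chain_group_order.
  exact: order_of_chain_N_free.
have chainP (le : G -> G -> Prop) : is_group_order le /\ N_free le ->
    [/\ is_two_coloured_chain (chain_of_order le),
        admissible (chain_of_order le) & reduced (chain_of_order le)].
  move=> [leG leN]; split; [exact: chain_two_coloured |
    exact: chain_admissible | exact: chain_reduced].
exists (fun C => exist _ _ (orderP _ (svalP C))).
exists (fun P => exist _ _ (chainP _ (svalP P))).
split=> [[c [c2 cadm cred]]|[le [leG leN]]|[c [c2 cadm cred]]|
         [le [leG leN]]] /=.
- by apply: eq_exist; apply: chain_of_orderK.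
- by apply: eq_exist; apply: order_of_chainK.
- split=> [g H g1 lH|x y]; last first.
    by rewrite !order_of_chain_strict invg1 mul1g.
  have sl : is_subgroup (lower (levels c) H).
    by apply: lower_subgroup; case: c2.
  have lH1 : least_level c (1^-1 * g) H by rewrite invg1 mul1g.
  split.
    rewrite order_of_chain_strict invg1 mul1g (chain_posE g1 lH).
    split=> [[CH q]|[CH [q _]]]; split=> //; split=> //.
    (* Strictness in the quotient: the coset of [g] is not H^-, because [g] is outside H^-. *)
    move=> /esym /(lcoset_of_memP _ sl); exact: least_not_lower lH.
  move=> AH; apply: incomparableC; apply: not_comparable => //.
    exact: nesym.
  by move/(comparable_typeC c2 cadm lH1 (nesym g1))/(typeCA c2).
- have L := chain_levels leG leN; split=> //.
    by move=> H X Y VH qX qY; split=> [[]|].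
  move=> g H g1; rewrite /least_level L is_SE.
  have lS := canonical_least leG g1.
  by split=> [lH|->//]; apply: least_unique lH lS.
Qed.
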